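(* Let $\jmath^*>1$ be an integer, let $v\in\mathbb{C}$, and let $G$ and $H_1$ be functions as described in the context (so $G(t,\varepsilon)$ is $2\pi/\jmath^*$-periodic in $t$). Consider the center bundle equation $$\dot p=e^{it}\Big[v+\varepsilon\, G(t,\varepsilon)+\mu_1 H_1\big(pe^{-it},\overline{p}\,e^{it},\mu_1\big)\Big],\qquad p\in\mathbb{C},\quad (\varepsilon,\mu_1)\in\mathbb{R}^2\text{ near }(0,0).\qquad ( * )$$ Let $\alpha_1=D_1H_1(-iv,i\overline{v},0)$ and assume that $\operatorname{Re}(\alpha_1)\neq 0$. Then there is a small deleted neighbourhood $\mathcal{W}^{\jmath^*}$ of the origin in $\mathbb{R}^2$ (that is, a small neighbourhood of $(0,0)$ with the point $(0,0)$ removed) such that for all $(\varepsilon,\mu_1)\in\mathcal{W}^{\jmath^*}$, equation $( * )$ has a unique hyperbolic discrete rotating wave $\mathcal{D}^{\jmath^*}_{\varepsilon,\mu_1}$ with $\mathbb{Z}_{\jmath^*}$-spatio-temporal symmetry and center $[\mathcal{D}^{\jmath^*}_{\varepsilon,\mu_1}]_{\mathrm A}=0$. Furthermore, $\mathcal{D}^{\jmath^*}_{\varepsilon,\mu_1}$ is anchored at the origin if $\operatorname{Re}(\alpha_1)\mu_1<0$.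
   Context: Equation $( * )$ is the reduced equation on the center bundle $\mathbb{C}\times\mathbb{S}^1$ (with $\varphi(t)=t$) near a normally hyperbolic rotating wave, in the case of one inhomogeneity located at the origin. Standing assumptions. $G(t,\varepsilon)$ is a smooth $\mathbb{C}$-valued function of $t\in\mathbb{R}$ and of $\varepsilon$ near $0$ in $\mathbb{R}$, and is $2\pi/\jmath^*$-periodic in $t$. $H_1(w,\overline{w},\mu_1)$ is a smooth (in the real sense) $\mathbb{C}$-valued function of $w\in\mathbb{C}$ and of $\mu_1$ near $0$ in $\mathbb{R}$, uniformly bounded in $w$. Notation. $D_1H_1$ is the partial derivative of $H_1$ with respect to its first argument, with $w$ and $\overline{w}$ treated as independent variables (i.e. the Wirtinger derivative $\partial/\partial w$). Thus $\alpha_1$ is this derivative at $w=-iv$, $\mu_1=0$. Definitions. A discrete rotating wave of $( * )$ with $\mathbb{Z}_{\jmath^*}$-spatio-temporal symmetry is a $2\pi$-periodic solution $p(t)$ of $( * )$ satisfying $p(t+2\pi/\jmath^* )=e^{2\pi i/\jmath^*}p(t)$ for all $t$ (equivalently, $e^{-it}p(t)$ is $2\pi/\jmath^*$-periodic). Its center is the average $[p]_{\mathrm A}=\frac{1}{2\pi}\int_0^{2\pi}p(t)\,dt$. It is hyperbolic if none of its Floquet multipliers (the eigenvalues of the derivative at $p(0)$, as a real $2\times2$ matrix, of the time-$2\pi$ map of $( * )$) lies on the unit circle. It is anchored at the point $[p]_{\mathrm A}$ if all its Floquet multipliers lie strictly inside the unit circle.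
   Formalization: Hyperbolicity is asserted only for μ₁ ≠ 0: at (ε,0) with ε ≠ 0 the right-hand side does not depend on p, so both Floquet multipliers are 1 and no solution is hyperbolic. There, existence, uniqueness of the discrete rotating wave, symmetry and center 0 are still claimed. *)

(* Defs.v *)
From Stdlib Require Import Reals.
From Coquelicot Require Import Coquelicot.

Open Scope R_scope.

(** [C^k] and [C^infinity] maps on an open set [D], in the real sense (see
    [C_R_NormedModule] below): a map is [C^(k+1)] when it is Fréchet
    differentiable on [D] and all its directional derivatives are [C^k].  In
    finite dimension this is the usual notion. *)
Fixpoint Ck_on {U V : NormedModule R_AbsRing}
    (k : nat) (D : U -> Prop) (f : U -> V) : Prop :=
  match k with
  | O => forall x, D x -> continuous f x
  | S k' => exists df : U -> U -> V,
      (forall x, D x -> filterdiff f (locally x) (df x)) /\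
      (forall h, Ck_on k' D (fun x => df x h))
  end.

Definition smooth_on {U V : NormedModule R_AbsRing}
    (D : U -> Prop) (f : U -> V) : Prop :=
  forall k, Ck_on k D f.

Definition cis (t : R) : C := (cos t, sin t).

(** [C] as a real normed space is [C_R_NormedModule]; Coquelicot's canonical
    structure on [C] is the complex one, hence the explicit annotations here
    and below. *)
Definition is_derive_C (p : R -> C) (t : R) (l : C) : Prop :=
  @is_derive R_AbsRing C_R_NormedModule p t l.

Definition admissible_G (j : nat) (G : R -> R -> C) : Prop :=
  exists delta : posreal,
    @smooth_on (prod_NormedModule R_AbsRing R_NormedModule R_NormedModule)
      C_R_NormedModule
      (fun x => Rabs (snd x) < delta) (fun x => G (fst x) (snd x)) /\
    (forall t eps, Rabs eps < delta -> G (t + 2 * PI / INR j) eps = G t eps).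

(** [H1 w mu] stands for [H_1(w, conj w, mu)]: [H_1] is only real-smooth in
    [w], and the argument [conj w] is not an independent variable. *)
Definition admissible_H1 (H1 : C -> R -> C) : Prop :=
  exists delta : posreal,
    @smooth_on (prod_NormedModule R_AbsRing C_R_NormedModule R_NormedModule)
      C_R_NormedModule
      (fun x => Rabs (snd x) < delta) (fun x => H1 (fst x) (snd x)) /\
    (exists M, forall w mu, Rabs mu < delta -> Cmod (H1 w mu) <= M).

Definition Derive_C (f : R -> C) (t : R) : C :=
  (Derive (fun s => Re (f s)) t, Derive (fun s => Im (f s)) t).

(** The Wirtinger derivative [df/dw = (df/dx - i df/dy) / 2], [w = x + i y]. *)
Definition wirtinger (f : C -> C) (w : C) : C :=
  ((Derive_C (fun x => f (x, Im w)) (Re w)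
    - Ci * Derive_C (fun y => f (Re w, y)) (Im w)) / 2)%C.

Definition alpha1 (v : C) (H1 : C -> R -> C) : C :=
  wirtinger (fun w => H1 w 0) (- (Ci * v))%C.

(** Right-hand side of the center bundle equation.  For [mu = 0] it does not
    depend on [p], so that all Floquet multipliers are equal to 1 and no
    solution is hyperbolic. *)
Definition center_bundle (v : C) (G : R -> R -> C) (H1 : C -> R -> C)
    (eps mu : R) (t : R) (p : C) : C :=
  (cis t * (v + eps * G t eps + mu * H1 (p * cis (- t)) mu))%C.

Definition solution_on (I : R -> Prop) (F : R -> C -> C) (p : R -> C) : Prop :=
  forall t, I t -> is_derive_C p t (F t (p t)).

Definition discrete_rotating_wave (j : nat) (F : R -> C -> C) (p : R -> C) :
    Prop :=
  solution_on (fun _ => True) F p /\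
  (forall t, p (t + 2 * PI) = p t) /\
  (forall t, p (t + 2 * PI / INR j) = (cis (2 * PI / INR j) * p t)%C).

Definition center (p : R -> C) : C :=
  (/ (2 * PI) * RInt (V := C_R_CompleteNormedModule) p 0 (2 * PI))%C.

(** [Phi] is the map [x(0) |-> x(2 pi)] along solutions starting near [z0]. *)
Definition time_2PI_map_near (F : R -> C -> C) (z0 : C) (Phi : C -> C) : Prop :=
  locally (T := C_R_NormedModule) z0 (fun z =>
    exists x : R -> C,
      solution_on (fun t => 0 <= t <= 2 * PI) F x /\
      x 0 = z /\ x (2 * PI) = Phi z).

Definition is_monodromy (F : R -> C -> C) (p : R -> C) (L : C -> C) : Prop :=
  exists Phi, time_2PI_map_near F (p 0) Phi /\
    @filterdiff R_AbsRing C_R_NormedModule C_R_NormedModule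
      Phi (locally (T := C_R_NormedModule) (p 0)) L.

(** [lam] is a complex eigenvalue of the real 2x2 matrix representing the
    real-linear map [L] in the basis [(1, i)]; [(x, y)] is an eigenvector. *)
Definition eigenvalue (L : C -> C) (lam : C) : Prop :=
  exists x y : C, (x, y) <> (RtoC 0, RtoC 0) /\
    (Re (L 1) * x + Re (L Ci) * y = lam * x)%C /\
    (Im (L 1) * x + Im (L Ci) * y = lam * y)%C.

Definition hyperbolic (F : R -> C -> C) (p : R -> C) : Prop :=
  exists L, is_monodromy F p L /\ forall lam, eigenvalue L lam -> Cmod lam <> 1.

Definition anchored_at (F : R -> C -> C) (p : R -> C) (z : C) : Prop :=
  center p = z /\
  exists L, is_monodromy F p L /\ forall lam, eigenvalue L lam -> Cmod lam < 1.

(* Main.v *)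
Require Import Defs.
From Stdlib Require Import Reals Lra Lia.
From Stdlib Require Import IndefiniteDescription FunctionalExtensionality.
From Coquelicot Require Import Coquelicot.

(** Write [zeta = cis T] with [T = 2 * PI / j], and [p t = w0 * cis t + y t] with
    [w0 = - i v]: the circle [w0 * cis t] is the symmetric solution for
    [eps = mu = 0]. The deviation [y] solves [y' = Y t y] with
    [Y t y = cis t * (eps * G t eps + mu * H1 (w0 + y * cis (- t)) mu)], which is
    bounded by [O(|eps| + |mu|)] on the whole plane, has Lipschitz constant
    [O(|mu|)] near [y = 0], and satisfies [Y (t + T) (zeta * y) = zeta * Y t y].

    Existence and uniqueness. Discrete rotating waves correspond to solutions with
    [y (t + T) = zeta * y t]. Since [zeta <> 1], these are exactly the solutions
    of [y t = / (zeta - 1) * int_t^(t + T) Y s (y s) ds]. Boundedness of [H1]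
    forces every such [y], wherever it lives, into a small ball, and on this ball
    the operator is a contraction ([rotating_wave_exists],
    [rotating_wave_unique]). This holds for [mu = 0] as well. The center vanishes
    because the average of [p] is multiplied by [zeta] under the time shift
    ([rotating_wave_centered]).

    Stability. The time-[2 * PI] map near [p 0] comes from the same contraction
    principle, and its derivative [L] from the variational equation
    ([flow_differentiable]). Near [w0] the derivative of [H1] in [w] is
    [h |-> alpha * h + beta * conj h] up to a small error, and in the rotating
    coordinates the second term becomes [beta * cis (2 * t) * conj h], of mean
    zero. Hence [L h = h + mu * (2 * PI * alpha + o(1)) * h]
    ([monodromy_expansion]). Up to the error this is multiplication by a complex
    number, whose modulus is below or above [1] according to the sign of
    [mu * Re alpha]; so [L] contracts every vector or expands every vector
    ([near_conformal_modulus]), and all its eigenvalues lie inside or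
    all lie outside the unit circle ([eigenvalue_lt_1], [eigenvalue_gt_1]). *)

Open Scope R_scope.


(** * Contraction estimates *)

Lemma geometric_small (D eps : R) :
  0 < eps -> exists N, forall n, (N <= n)%nat -> D * (1 / 2) ^ n < eps.
Proof.
  intros He.
  assert (HD : 0 < Rmax D 1) by (apply Rlt_le_trans with 1; [lra | apply Rmax_r]).
  destruct (pow_lt_1_zero (1 / 2)) with (y := eps / Rmax D 1) as [N HN].
  - rewrite Rabs_pos_eq; lra.
  - now apply Rdiv_lt_0_compat.
  - exists N. intros n Hn. specialize (HN n Hn).
    assert (Hp : 0 < (1 / 2) ^ n) by (apply pow_lt; lra).
    rewrite Rabs_pos_eq in HN by lra.
    apply (Rmult_lt_compat_r (Rmax D 1)) in HN; [| lra].
    unfold Rdiv in HN at 2. rewrite Rmult_assoc, Rinv_l in HN by lra.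
    assert (D * (1 / 2) ^ n <= Rmax D 1 * (1 / 2) ^ n)
      by (apply Rmult_le_compat_r; [lra | apply Rmax_l]).
    lra.
Qed.

(** Iterating the step drives any a priori bound down to the fixed point
    [2 * e] of [D |-> e + D / 2]. All comparisons of solutions below go through
    this principle, which stands in for Gronwall's inequality when the
    Lipschitz constant times the length of the interval is at most [1 / 2]. *)
Lemma self_improving_bound {X : Type} (P : X -> Prop) (u : X -> R) (D0 e : R) :
  0 <= e ->
  (forall t, P t -> u t <= D0) ->
  (forall D, 0 <= D -> (forall t, P t -> u t <= D) ->
     forall t, P t -> u t <= e + D / 2) ->
  forall t, P t -> u t <= 2 * e.
Proof.
  intros He H0 Hstep.
  assert (HD : 0 <= Rmax D0 0) by apply Rmax_r.
  assert (Hn : forall n t, P t -> u t <= 2 * e + Rmax D0 0 * (1 / 2) ^ n).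
  { induction n as [| n IH]; intros t Ht.
    - specialize (H0 t Ht). pose proof (Rmax_l D0 0). simpl. lra.
    - assert (Hp : 0 < (1 / 2) ^ n) by (apply pow_lt; lra).
      assert (0 <= Rmax D0 0 * (1 / 2) ^ n) by (apply Rmult_le_pos; lra).
      assert (H1 : u t <= e + (2 * e + Rmax D0 0 * (1 / 2) ^ n) / 2)
        by (apply Hstep; auto; lra).
      simpl. lra. }
  intros t Ht. apply le_epsilon. intros eps Heps.
  destruct (geometric_small (Rmax D0 0) eps Heps) as [N HN].
  specialize (HN N (le_n N)). specialize (Hn N t Ht). lra.
Qed.

Section VectorIdentities.
Context {V : AbelianGroup}.

Let minusE (a b : V) : minus a b = plus a (opp b) := eq_refl.

Let addA (a b c : V) : plus a (plus b c) = plus (plus a b) c := plus_assoc a b c.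
Let addC (a b : V) : plus a b = plus b a := plus_comm a b.
Let addN (a : V) : plus a (opp a) = zero := plus_opp_r a.
Let add0 (a : V) : plus a zero = a := plus_zero_r a.

Lemma minus_plus_plus (a b c d : V) :
  minus (plus a b) (plus c d) = plus (minus a c) (minus b d).
Proof.
  rewrite !minusE. rewrite (opp_plus c d), !addA. f_equal.
  rewrite <- !addA. f_equal. apply addC.
Qed.

Lemma minus_minus_comm (a b c d : V) :
  minus (minus a b) (minus c d) = minus (minus a c) (minus b d).
Proof.
  rewrite (minusE a b), (minusE c d), minus_plus_plus, (minusE (opp b)).
  now rewrite (minusE (minus a c)), (minusE b d), opp_plus.
Qed.

Lemma minus_zero_eq (a b : V) : minus a b = zero -> a = b.
Proof.
  intros H. rewrite <- (add0 a), <- (addN b), (addC b), addA, <- minusE, H, addC.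
  apply add0.
Qed.

Lemma minus_plus_cancel (a b : V) : plus (minus a b) b = a.
Proof.
  rewrite !minusE. now rewrite <- addA, (addC (opp b)), addN, add0.
Qed.

Lemma plus_minus_cancel (a b : V) : minus (plus a b) a = b.
Proof.
  rewrite !minusE. now rewrite (addC a b), <- addA, addN, add0.
Qed.

Lemma plus_minus_cancel_r (a b : V) : minus (plus a b) b = a.
Proof. rewrite addC. apply plus_minus_cancel. Qed.
End VectorIdentities.

Section NormedSpace.
Context {V : NormedModule R_AbsRing}.

Lemma norm_minus_sym (x y : V) : norm (minus x y) = norm (minus y x).
Proof. rewrite <- (norm_opp (minus x y)). now rewrite opp_minus. Qed.

Lemma norm_minus_diag (x : V) : norm (minus x x) = 0.
Proof. rewrite minus_eq_zero. apply norm_zero. Qed.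

Lemma eq_of_norm_minus (x y : V) : norm (minus x y) <= 0 -> x = y.
Proof.
  intros H. apply minus_zero_eq, norm_eq_zero.
  apply Rle_antisym; [exact H | apply norm_ge_0].
Qed.

Lemma norm_minus_le (x y : V) : norm (minus x y) <= norm x + norm y.
Proof.
  rewrite <- (norm_opp y). apply norm_triangle.
Qed.

Lemma norm_minus_triangle (y x z : V) :
  norm (minus x z) <= norm (minus x y) + norm (minus y z).
Proof. rewrite (minus_trans y x z). apply norm_triangle. Qed.

Lemma norm_le_of_minus (x y : V) : norm x <= norm (minus x y) + norm y.
Proof.
  rewrite <- (minus_plus_cancel x y) at 1. apply norm_triangle.
Qed.

Lemma is_RInt_norm_le (f : R -> V) (a b B M : R) (l : V) :
  Rabs (b - a) <= B -> 0 <= M ->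
  (forall s, Rmin a b <= s <= Rmax a b -> norm (f s) <= M) ->
  is_RInt f a b l -> norm l <= B * M.
Proof.
  intros HB HM Hf Hl.
  apply Rle_trans with (Rabs (b - a) * M); [| now apply Rmult_le_compat_r].
  destruct (Rle_dec a b) as [Hab | Hab].
  - rewrite Rabs_pos_eq by lra. apply (norm_RInt_le_const f a b l M); auto.
    intros s Hs. apply Hf. now rewrite Rmin_left, Rmax_right.
  - rewrite <- (norm_opp l), Rabs_minus_sym, Rabs_pos_eq by lra.
    apply (norm_RInt_le_const f b a (opp l) M); [lra | |].
    + intros s Hs. apply Hf. now rewrite Rmin_right, Rmax_left by lra.
    + now apply is_RInt_swap.
Qed.

Lemma continuous_of_norm (x : R -> V) (t : R) :
  (forall eps, 0 < eps -> locally t (fun s => norm (minus (x s) (x t)) < eps)) ->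
  continuous x t.
Proof.
  intros H. apply filterlim_locally. intros eps.
  generalize (H eps (cond_pos eps)). apply filter_imp.
  intros s Hs. now apply norm_compat1.
Qed.

Lemma norm_of_continuous {U : UniformSpace} (x : U -> V) (t : U) (eps : R) :
  continuous x t -> 0 < eps ->
  locally t (fun s => norm (minus (x s) (x t)) < eps).
Proof.
  intros H He. apply (H (fun y => norm (minus y (x t)) < eps)).
  apply (locally_le_locally_norm (x t)). now exists (mkposreal eps He).
Qed.
End NormedSpace.

(** * Integral equations in a Banach space *)

Section IntegralEquation.
Context {V : CompleteNormedModule R_AbsRing}.
Let W : NormedModule R_AbsRing := V.

Lemma continuous_RInt_bounds (f : R -> W) (a b : R -> R) (t : R) :
  (forall s, continuous f s) -> continuous a t -> continuous b t ->
  continuous (fun s => RInt (V := V) f (a s) (b s)) t.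
Proof.
  intros Hf Ha Hb.
  apply (continuous_comp_2 a b (fun u w => RInt (V := V) f u w) t Ha Hb).
  apply (continuous_RInt (V := V) f (a t) (b t) (fun u w => RInt (V := V) f u w)).
  apply filter_forall. intros z. apply RInt_correct, ex_RInt_continuous. auto.
Qed.

(** The integral operator halves distances and preserves the ball of radius
    [r], so its iterates from [0] converge uniformly. The bounds [a] and [b] of
    the integral vary with [t]: the initial value problem takes [0] and [t], the
    search for a rotating wave takes [t] and [t + T]. *)
Lemma integral_equation_solvable (g : R -> W) (a b : R -> R) (A : R -> W -> W)
    (B M K r : R) :
  (forall t, continuous g t) -> (forall t, continuous a t) ->
  (forall t, continuous b t) -> (forall t, Rabs (b t - a t) <= B) ->
  0 <= M -> 0 <= K -> 0 <= r ->
  (forall x : R -> W, (forall t, continuous x t) -> (forall t, norm (x t) <= r) ->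
     forall s, continuous (fun s => A s (x s)) s) ->
  (forall s x, norm x <= r -> norm (A s x) <= M) ->
  (forall s x y, norm x <= r -> norm y <= r ->
     norm (minus (A s x) (A s y)) <= K * norm (minus x y)) ->
  (forall t, norm (g t) + B * M <= r) -> B * K <= 1 / 2 ->
  exists x : R -> W, (forall t, continuous x t) /\ (forall t, norm (x t) <= r) /\
    forall t, is_RInt (fun s => A s (x s)) (a t) (b t) (minus (x t) (g t)).
Proof.
  intros Hg Ha Hb HB HM HK Hr HAc HAM HAK Hgr HBK.
  set (Op := fun (x : R -> W) t => plus (g t) (RInt (V := V) (fun s => A s (x s)) (a t) (b t))).
  set (ok := fun x : R -> W => (forall t, continuous x t) /\ forall t, norm (x t) <= r).
  assert (Hint : forall x, ok x -> forall u w,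
            is_RInt (fun s => A s (x s)) u w (RInt (V := V) (fun s => A s (x s)) u w)).
  { intros x [Hx Hxr] u w. apply RInt_correct, ex_RInt_continuous. intros; auto. }
  assert (HOp : forall x, ok x -> ok (Op x)).
  { intros x Hx. pose proof (Hint x Hx) as HI. destruct Hx as [Hx Hxr]. split.
    - intros t.
      apply (continuous_plus g (fun t => RInt (V := V) (fun s => A s (x s)) (a t) (b t))); auto.
      apply continuous_RInt_bounds; auto.
    - intros t. unfold Op. eapply Rle_trans; [apply (norm_triangle (V := W)) |].
      apply Rle_trans with (2 := Hgr t). apply Rplus_le_compat_l.
      apply (is_RInt_norm_le (V := W) (fun s => A s (x s)) (a t) (b t)); auto. }
  assert (Hcontr : forall x y D, ok x -> ok y ->
            (forall t, norm (minus (x t) (y t)) <= D) ->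
            forall t, norm (minus (Op x t) (Op y t)) <= D / 2).
  { intros x y D Hx Hy HD t.
    assert (HD0 : 0 <= D) by (eapply Rle_trans; [apply (norm_ge_0 (V := W)) | apply (HD 0)]).
    unfold Op. rewrite (minus_plus_plus (V := W)), minus_eq_zero, plus_zero_l.
    apply Rle_trans with (B * (K * D)).
    - eapply (is_RInt_norm_le (V := W)); [apply HB | now apply Rmult_le_pos | |
        apply (is_RInt_minus (V := W) _ _ _ _ _ _ (Hint x Hx _ _) (Hint y Hy _ _))].
      intros s _. destruct Hx, Hy. eapply Rle_trans; [apply HAK; auto |].
      apply Rmult_le_compat_l; auto.
    - rewrite <- Rmult_assoc. replace (D / 2) with (1 / 2 * D) by field.
      now apply Rmult_le_compat_r. }
  set (it := fun n => Nat.iter n Op (fun _ => zero)).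
  assert (Hit : forall n, ok (it n)).
  { induction n as [| n IH]; simpl.
    - split; intros t; [apply continuous_const | eapply Rle_trans; [apply Req_le, (norm_zero (V := W)) | auto]].
    - now apply HOp. }
  assert (Hstep : forall n t, norm (minus (it (S n) t) (it n t)) <= r * (1 / 2) ^ n).
  { induction n as [| n IH]; intros t.
    - simpl pow. rewrite Rmult_1_r. destruct (Hit 1%nat) as [_ H].
      apply Rle_trans with (2 := H t). apply Req_le. f_equal.
      apply (minus_zero_r (G := W)).
    - change (norm (minus (Op (it (S n)) t) (Op (it n) t)) <= r * (1 / 2) ^ S n).
      eapply Rle_trans; [apply (Hcontr _ _ (r * (1 / 2) ^ n)); auto |].
      simpl. apply Req_le. field. }
  assert (Htail : forall n k t,
            norm (minus (it (n + k)%nat t) (it n t)) <= 2 * r * (1 / 2) ^ n).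
  { intros n k t.
    assert (norm (minus (it (n + k)%nat t) (it n t))
            <= 2 * r * (1 / 2) ^ n - 2 * r * (1 / 2) ^ (n + k)).
    { induction k as [| k IH].
      - rewrite Nat.add_0_r, Rminus_diag, (minus_eq_zero (G := W)).
        apply Req_le, (norm_zero (V := W)).
      - rewrite Nat.add_succ_r.
        eapply Rle_trans; [apply (norm_minus_triangle (V := W) (it (n + k)%nat t)) |].
        specialize (Hstep (n + k)%nat t).
        change ((1 / 2) ^ S (n + k)) with (1 / 2 * (1 / 2) ^ (n + k)). lra. }
    assert (0 <= 2 * r * (1 / 2) ^ (n + k))
      by (apply Rmult_le_pos; [lra | apply pow_le; lra]).
    lra. }
  assert (Hlim : forall t, exists l : W, forall n, norm (minus l (it n t)) <= 2 * r * (1 / 2) ^ n).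
  { intros t.
    destruct (proj1 (filterlim_locally_cauchy (U := V) (F := eventually) (fun n => it n t))) as [l Hl].
    { intros eps. destruct (geometric_small (4 * r) eps (cond_pos eps)) as [N HN].
      exists (fun n => (N <= n)%nat). split; [now exists N |].
      intros p q Hp Hq. apply (norm_compat1 (V := W)).
      eapply Rle_lt_trans; [apply (norm_minus_triangle (V := W) (it N t)) |].
      rewrite (norm_minus_sym (V := W) (it N t)).
      replace p with (N + (p - N))%nat by lia. replace q with (N + (q - N))%nat by lia.
      pose proof (Htail N (p - N)%nat t). pose proof (Htail N (q - N)%nat t).
      specialize (HN N (le_n N)). lra. }
    exists l. intros n. apply le_epsilon. intros eps Heps.
    assert (Hloc : locally l (fun y => norm (minus y l) < eps)).
    { apply (locally_le_locally_norm l). now exists (mkposreal eps Heps). }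
    destruct (Hl _ Hloc) as [N HN].
    specialize (HN (n + N)%nat (Nat.le_add_l N n)).
    rewrite (norm_minus_sym (V := W)) in HN. specialize (Htail n N t).
    pose proof (norm_minus_triangle (V := W) (it (n + N)%nat t) l (it n t)). lra. }
  destruct (functional_choice _ Hlim) as [x Hx].
  assert (Hok : ok x).
  { split.
    - intros t. apply continuous_of_norm. intros eps Heps.
      destruct (geometric_small (2 * r) (eps / 3)) as [N HN]; [lra |].
      specialize (HN N (le_n N)).
      assert (He3 : 0 < eps / 3) by lra.
      generalize (norm_of_continuous (it N) t (eps / 3) (proj1 (Hit N) t) He3).
      apply filter_imp. intros s Hs.
      pose proof (Hx s N). pose proof (Hx t N).
      pose proof (norm_minus_triangle (V := W) (it N s) (x s) (x t)).
      pose proof (norm_minus_triangle (V := W) (it N t) (it N s) (x t)).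
      rewrite (norm_minus_sym (V := W) (it N t) (x t)) in *. lra.
    - intros t. apply le_epsilon. intros eps Heps.
      destruct (geometric_small (2 * r) eps Heps) as [N HN].
      specialize (HN N (le_n N)). pose proof (Hx t N).
      pose proof (norm_le_of_minus (V := W) (x t) (it N t)). pose proof (proj2 (Hit N) t). lra. }
  exists x. split; [apply Hok | split; [apply Hok |]]. intros t.
  assert (Hfix : Op x t = x t).
  { apply (eq_of_norm_minus (V := W)). apply le_epsilon. intros eps Heps.
    destruct (geometric_small (2 * r) eps Heps) as [N HN].
    pose proof (Hcontr x (it N) _ Hok (Hit N) (fun t => Hx t N) t) as Hc.
    change (Op (it N) t) with (it (S N) t) in Hc.
    pose proof (Hx t (S N)) as Hs. rewrite (norm_minus_sym (V := W)) in Hs.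
    pose proof (norm_minus_triangle (V := W) (it (S N) t) (Op x t) (x t)).
    specialize (HN N (le_n N)).
    assert (0 <= 2 * r * (1 / 2) ^ N) by (apply Rmult_le_pos; [lra | apply pow_le; lra]).
    change ((1 / 2) ^ S N) with (1 / 2 * (1 / 2) ^ N) in Hs. lra. }
  assert (E : minus (x t) (g t) = RInt (V := V) (fun s => A s (x s)) (a t) (b t)).
  { rewrite <- Hfix. apply (plus_minus_cancel (V := W)). }
  rewrite E. now apply Hint.
Qed.

(** The distance of two solutions obeys a self-improving bound; the case
    [e = 0] is uniqueness. *)
Lemma integral_equation_stable (I : R -> Prop) (g1 g2 x y : R -> W) (a b : R -> R)
    (A : R -> W -> W) (B K r e : R) :
  (forall t, I t -> Rabs (b t - a t) <= B) -> 0 <= K -> 0 <= e ->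
  (forall t s, I t -> Rmin (a t) (b t) <= s <= Rmax (a t) (b t) -> I s) ->
  (forall s x y, norm x <= r -> norm y <= r ->
     norm (minus (A s x) (A s y)) <= K * norm (minus x y)) ->
  B * K <= 1 / 2 ->
  (forall t, I t -> norm (x t) <= r) -> (forall t, I t -> norm (y t) <= r) ->
  (forall t, I t -> is_RInt (fun s => A s (x s)) (a t) (b t) (minus (x t) (g1 t))) ->
  (forall t, I t -> is_RInt (fun s => A s (y s)) (a t) (b t) (minus (y t) (g2 t))) ->
  (forall t, I t -> norm (minus (g1 t) (g2 t)) <= e) ->
  forall t, I t -> norm (minus (x t) (y t)) <= 2 * e.
Proof.
  intros HB HK He HI HAK HBK Hxr Hyr Hx Hy Hg.
  apply (self_improving_bound I (fun t => norm (minus (x t) (y t))) (2 * r) e He).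
  - intros t Ht. eapply Rle_trans; [apply norm_minus_le |].
    specialize (Hxr t Ht). specialize (Hyr t Ht). lra.
  - intros D HD HxyD t Ht.
    pose proof (is_RInt_minus _ _ _ _ _ _ (Hx t Ht) (Hy t Ht)) as Hd.
    apply is_RInt_norm_le with (B := B) (M := K * D) in Hd;
      [| now apply HB | now apply Rmult_le_pos |].
    + rewrite minus_minus_comm in Hd.
      pose proof (norm_le_of_minus (V := W) (minus (x t) (y t)) (minus (g1 t) (g2 t))).
      specialize (Hg t Ht).
      assert (B * (K * D) <= D / 2).
      { rewrite <- Rmult_assoc. replace (D / 2) with (1 / 2 * D) by field.
        now apply Rmult_le_compat_r. }
      lra.
    + intros s Hs. pose proof (HI t s Ht Hs).
      eapply Rle_trans; [apply HAK; auto |]. apply Rmult_le_compat_l; auto.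
Qed.
End IntegralEquation.

(** * Smooth dependence on the initial value *)

Section Flow.
Context {V : CompleteNormedModule R_AbsRing}.
Let W : NormedModule R_AbsRing := V.

(** Time is clamped to [[-B, B]], which keeps the interval of integration
    bounded while the unknown stays defined on the whole line; solutions on
    [[0, 2 * PI]] then have two-sided derivatives at the end points as soon as
    [2 * PI < B]. *)
Lemma initial_value_problem_solvable (F : R -> W -> W) (z : W) (B M K r : R) :
  0 <= B -> 0 <= M -> 0 <= K -> 0 <= r ->
  (forall x : R -> W, (forall t, continuous x t) -> (forall t, norm (x t) <= r) ->
     forall s, continuous (fun s => F s (x s)) s) ->
  (forall s x, norm x <= r -> norm (F s x) <= M) ->
  (forall s x y, norm x <= r -> norm y <= r ->
     norm (minus (F s x) (F s y)) <= K * norm (minus x y)) ->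
  norm z + B * M <= r -> B * K <= 1 / 2 ->
  exists x : R -> W, (forall t, continuous x t) /\ (forall t, norm (x t) <= r) /\
    forall t, Rabs t <= B -> is_RInt (fun s => F s (x s)) 0 t (minus (x t) z).
Proof.
  intros HB HM HK Hr HFc HFM HFK Hz HBK.
  set (clamp := fun t => (Rabs (t + B) - Rabs (t - B)) / 2).
  assert (Hc : forall t, continuous clamp t).
  { intros t. apply continuity_pt_filterlim. unfold clamp. reg. }
  destruct (integral_equation_solvable (fun _ => z) (fun _ => 0) clamp F B M K r)
    as (x & Hx & Hxr & Hxi); auto.
  - intros t. apply continuous_const.
  - intros t. apply continuous_const.
  - intros t. unfold clamp. clear - HB. unfold Rabs.
    repeat destruct Rcase_abs; lra.
  - exists x. repeat split; auto. intros t Ht. specialize (Hxi t).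
    replace (clamp t) with t in Hxi; [exact Hxi |].
    unfold clamp. apply Rabs_le_between in Ht.
    rewrite Rabs_pos_eq, (Rabs_left1 (t - B)) by lra. lra.
Qed.

Lemma initial_value_problem_stable (F : R -> W -> W) (x y : R -> W) (z z' : W)
    (B K r : R) :
  0 <= K ->
  (forall s x y, norm x <= r -> norm y <= r ->
     norm (minus (F s x) (F s y)) <= K * norm (minus x y)) ->
  B * K <= 1 / 2 ->
  (forall t, norm (x t) <= r) -> (forall t, norm (y t) <= r) ->
  (forall t, Rabs t <= B -> is_RInt (fun s => F s (x s)) 0 t (minus (x t) z)) ->
  (forall t, Rabs t <= B -> is_RInt (fun s => F s (y s)) 0 t (minus (y t) z')) ->
  forall t, Rabs t <= B -> norm (minus (x t) (y t)) <= 2 * norm (minus z z').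
Proof.
  intros HK HF HBK Hxr Hyr Hx Hy.
  apply (integral_equation_stable (fun t => Rabs t <= B) (fun _ => z) (fun _ => z')
           x y (fun _ => 0) (fun t => t) F B K r (norm (minus z z'))); auto.
  - intros t Ht. now rewrite Rminus_0_r.
  - apply norm_ge_0.
  - intros t s Ht Hs. apply Rabs_le_between in Ht. apply Rabs_le_between.
    revert Hs. unfold Rmin, Rmax. destruct Rle_dec; lra.
  - intros t _. apply Rle_refl.
Qed.

(** The derivative of the flow in the initial value solves the variational
    equation: with [h] the displacement, the remainder
    [X (y0 0 + h) t - y0 t - U h t] satisfies an integral inequality whose
    inhomogeneity is the second order Taylor remainder of [F]. *)
Lemma flow_differentiable (F A : R -> W -> W) (y0 : R -> W) (B M K K2 r : R) :
  0 <= B -> 0 <= M -> 0 <= K -> 0 <= K2 -> 0 < r ->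
  (forall x : R -> W, (forall t, continuous x t) -> (forall t, norm (x t) <= r) ->
     forall s, continuous (fun s => F s (x s)) s) ->
  (forall s x, norm x <= r -> norm (F s x) <= M) ->
  (forall s x y, norm x <= r -> norm y <= r ->
     norm (minus (F s x) (F s y)) <= K * norm (minus x y)) ->
  B * M <= r / 4 -> B * K <= 1 / 2 ->
  (forall t, norm (y0 t) <= r / 2) ->
  (forall t, Rabs t <= B ->
     is_RInt (fun s => F s (y0 s)) 0 t (minus (y0 t) (y0 0))) ->
  (forall s x y, A s (plus x y) = plus (A s x) (A s y)) ->
  (forall s k x, A s (scal k x) = scal k (A s x)) ->
  (forall s x, norm (A s x) <= K * norm x) ->
  (forall x : R -> W, (forall t, continuous x t) ->
     forall s, continuous (fun s => A s (x s)) s) ->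
  (forall s x, norm x <= r ->
     norm (minus (minus (F s x) (F s (y0 s))) (A s (minus x (y0 s))))
     <= K2 * norm (minus x (y0 s)) ^ 2) ->
  exists X U : W -> R -> W,
    (forall z, norm z <= 3 / 4 * r ->
       (forall t, continuous (X z) t) /\ (forall t, norm (X z t) <= r) /\
       forall t, Rabs t <= B -> is_RInt (fun s => F s (X z s)) 0 t (minus (X z t) z)) /\
    (forall h,
       (forall t, continuous (U h) t) /\ (forall t, norm (U h t) <= 2 * norm h) /\
       forall t, Rabs t <= B -> is_RInt (fun s => A s (U h s)) 0 t (minus (U h t) h)) /\
    forall t, Rabs t <= B ->
      filterdiff (fun z => X z t) (locally (y0 0)) (fun h => U h t).
Proof.
  intros HB HM HK HK2 Hr HFc HFM HFK HBM HBK Hy0r Hy0 HAp HAs HAn HAc HT.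
  assert (HX : forall z : W, exists x : R -> W, norm z <= 3 / 4 * r ->
    (forall t, continuous x t) /\ (forall t, norm (x t) <= r) /\
    forall t, Rabs t <= B -> is_RInt (fun s => F s (x s)) 0 t (minus (x t) z)).
  { intros z. destruct (Rle_dec (norm z) (3 / 4 * r)) as [Hz | Hz].
    - destruct (initial_value_problem_solvable F z B M K r) as [x Hx]; auto; try lra.
      now exists x.
    - exists (fun _ => z). intros Hz'. contradiction. }
  assert (HAm : forall s x y, minus (A s x) (A s y) = A s (minus x y)).
  { intros s x y.
    assert (E : A s x = plus (A s (minus x y)) (A s y)).
    { rewrite <- HAp. f_equal. symmetry. apply (minus_plus_cancel (V := W)). }
    rewrite E. apply (plus_minus_cancel_r (V := W)). }
  assert (HU : forall h : W, exists u : R -> W,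
    (forall t, continuous u t) /\ (forall t, norm (u t) <= 2 * norm h) /\
    forall t, Rabs t <= B -> is_RInt (fun s => A s (u s)) 0 t (minus (u t) h)).
  { intros h. pose proof (norm_ge_0 h) as Hh.
    destruct (initial_value_problem_solvable A h B (K * (2 * norm h)) K (2 * norm h))
      as [u Hu]; auto; try lra.
    - apply Rmult_le_pos; lra.
    - intros s x Hx. eapply Rle_trans; [apply HAn |]. now apply Rmult_le_compat_l.
    - intros s x y _ _. rewrite HAm. apply HAn.
    - rewrite <- Rmult_assoc.
      assert (B * K * (2 * norm h) <= 1 / 2 * (2 * norm h))
        by (apply Rmult_le_compat_r; lra). lra.
    - now exists u. }
  destruct (functional_choice _ HX) as [X HX'].
  destruct (functional_choice _ HU) as [U HU'].
  exists X, U. split; [exact HX' | split; [exact HU' |]].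
  (* Solutions of the variational equation are determined by their initial value. *)
  assert (HUu : forall (u : R -> W) h b, (forall t, norm (u t) <= b) ->
    (forall t, Rabs t <= B -> is_RInt (fun s => A s (u s)) 0 t (minus (u t) h)) ->
    forall t, Rabs t <= B -> u t = U h t).
  { intros u h b Hub Hu t Ht. destruct (HU' h) as (_ & HUb & HUi).
    apply (eq_of_norm_minus (V := W)).
    replace 0 with (2 * norm (minus h h)) by (rewrite (norm_minus_diag (V := W)); ring).
    apply (initial_value_problem_stable A u (U h) h h B K (Rmax b (2 * norm h))); auto.
    - intros s x y _ _. rewrite HAm. apply HAn.
    - intros s. eapply Rle_trans; [apply Hub | apply Rmax_l].
    - intros s. eapply Rle_trans; [apply HUb | apply Rmax_r]. }
  intros t Ht. split.
  - apply Build_is_linear.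
    + intros h k. symmetry.
      destruct (HU' h) as (_ & Hhb & Hhi). destruct (HU' k) as (_ & Hkb & Hki).
      apply (HUu (fun s => plus (U h s) (U k s)) (plus h k) (2 * norm h + 2 * norm k));
        [| | exact Ht].
      * intros s. eapply Rle_trans; [apply norm_triangle |].
        now apply Rplus_le_compat.
      * intros s Hs. rewrite (minus_plus_plus (V := W)).
        apply (is_RInt_ext (fun s => plus (A s (U h s)) (A s (U k s)))).
        -- intros; symmetry; apply HAp.
        -- apply is_RInt_plus; auto.
    + intros k h. symmetry. destruct (HU' h) as (_ & Hhb & Hhi).
      apply (HUu (fun s => scal k (U h s)) (scal k h) (Rabs k * (2 * norm h)));
        [| | exact Ht].
      * intros s. eapply Rle_trans; [apply norm_scal |].
        apply Rmult_le_compat_l; [apply Rabs_pos | apply Hhb].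
      * intros s Hs.
        apply (is_RInt_ext (fun s => scal k (A s (U h s)))).
        -- intros; symmetry; apply HAs.
        -- pose proof (is_RInt_scal (V := W) _ _ _ k _ (Hhi s Hs)) as Hk.
           rewrite (scal_minus_distr_l (V := W)) in Hk. exact Hk.
    + exists 2. split; [lra |]. intros h. apply (HU' h).
  - intros z0 Hz0. apply is_filter_lim_locally_unique in Hz0. subst z0.
    intros eps. set (C0 := 8 * (B * K2)).
    assert (HC0 : 0 <= C0) by (unfold C0; assert (0 <= B * K2) by (apply Rmult_le_pos; lra); lra).
    set (d := Rmin (r / 4) (eps / (C0 + 1))).
    assert (Hd : 0 < d).
    { apply Rmin_pos; [lra |]. apply Rdiv_lt_0_compat; [apply cond_pos | lra]. }
    assert (Hloc : locally (y0 0) (fun z => norm (minus z (y0 0)) < d)).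
    { apply (locally_le_locally_norm (y0 0)). now exists (mkposreal d Hd). }
    revert Hloc. apply filter_imp. intros z Hz.
    set (h := minus z (y0 0)) in *.
    assert (Hzr : norm z <= 3 / 4 * r).
    { pose proof (norm_le_of_minus z (y0 0)) as H. fold h in H.
      pose proof (Rmin_l (r / 4) (eps / (C0 + 1))). fold d in H0.
      pose proof (Hy0r 0). lra. }
    destruct (HX' z Hzr) as (_ & Hxr & Hxi).
    assert (Hy0' : forall t, norm (y0 t) <= r) by (intros s; pose proof (Hy0r s); lra).
    assert (Hy00 : norm (y0 0) <= 3 / 4 * r) by (pose proof (Hy0r 0); lra).
    destruct (HX' (y0 0) Hy00) as (_ & Hwr & Hwi).
    assert (Hbase : X (y0 0) t = y0 t).
    { apply (eq_of_norm_minus (V := W)). apply Rle_trans with (2 * norm (minus (y0 0) (y0 0)));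
        [| rewrite (norm_minus_diag (V := W)); lra].
      apply (initial_value_problem_stable F _ _ (y0 0) (y0 0) B K r); auto. }
    rewrite Hbase.
    destruct (HU' h) as (_ & Hub & Hui).
    assert (Hclose : forall s, Rabs s <= B -> norm (minus (X z s) (y0 s)) <= 2 * norm h).
    { apply (initial_value_problem_stable F _ _ z (y0 0) B K r); auto. }
    pose proof (norm_ge_0 h) as Hh0.
    assert (Hrem : norm (minus (minus (X z t) (y0 t)) (U h t))
                   <= 2 * (B * (K2 * (2 * norm h) ^ 2))).
    { refine (self_improving_bound (fun s => Rabs s <= B)
        (fun s => norm (minus (minus (X z s) (y0 s)) (U h s))) (4 * norm h) _ _ _ _ t Ht).
      - apply Rmult_le_pos; [lra |]. apply Rmult_le_pos; [lra | apply pow2_ge_0].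
      - intros s Hs. eapply Rle_trans; [apply norm_minus_le |].
        specialize (Hclose s Hs). specialize (Hub s). lra.
      - intros D HD HDb s Hs.
        pose proof (is_RInt_minus _ _ _ _ _ _
          (is_RInt_minus _ _ _ _ _ _ (Hxi s Hs) (Hy0 s Hs)) (Hui s Hs)) as Hi.
        rewrite (minus_minus_comm (V := W) (X z s)), (minus_minus_comm (V := W) (minus (X z s) (y0 s))) in Hi.
        fold h in Hi.
        assert (Eh : minus (minus (minus (X z s) (y0 s)) (U h s)) (minus h h)
                     = minus (minus (X z s) (y0 s)) (U h s))
          by (rewrite (minus_eq_zero (G := W)); apply (minus_zero_r (G := W))).
        rewrite Eh in Hi.
        apply is_RInt_norm_le with (B := B) (M := K2 * (2 * norm h) ^ 2 + K * D) in Hi.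
        + eapply Rle_trans; [exact Hi |].
          rewrite Rmult_plus_distr_l, <- (Rmult_assoc B K D). apply Rplus_le_compat_l.
          replace (D / 2) with (1 / 2 * D) by field. now apply Rmult_le_compat_r.
        + now rewrite Rminus_0_r.
        + apply Rplus_le_le_0_compat; apply Rmult_le_pos; auto. apply pow2_ge_0.
        + intros q Hq.
          assert (Hq' : Rabs q <= B).
          { apply Rabs_le_between in Hs. apply Rabs_le_between.
            revert Hq. unfold Rmin, Rmax. destruct Rle_dec; lra. }
          eapply Rle_trans;
            [apply (norm_minus_triangle (A q (minus (X z q) (y0 q)))) |].
          apply Rplus_le_compat.
          * eapply Rle_trans; [apply HT; auto |].
            apply Rmult_le_compat_l; [auto |].
            apply pow_incr. split; [apply norm_ge_0 | now apply Hclose].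
          * rewrite HAm. eapply Rle_trans; [apply HAn |].
            apply Rmult_le_compat_l; auto. }
    eapply Rle_trans; [exact Hrem |].
    replace (2 * (B * (K2 * (2 * norm h) ^ 2))) with (C0 * norm h * norm h)
      by (unfold C0; ring).
    apply Rmult_le_compat_r; [lra |].
    pose proof (Rmin_r (r / 4) (eps / (C0 + 1))) as Hd2. fold d in Hd2.
    apply Rle_trans with ((C0 + 1) * (eps / (C0 + 1))); [| right; field; lra].
    apply Rmult_le_compat; lra.
Qed.
End Flow.

(** * Complex-valued functions of a real variable *)

Notation continuous_C := (@continuous R_UniformSpace C_UniformSpace).
Notation is_RInt_C := (@is_RInt C_R_NormedModule).

Lemma norm_C (z : C) : @norm R_AbsRing C_R_NormedModule z = Cmod z.
Proof.
  unfold Cmod. change (sqrt (Rabs (fst z) ^ 2 + Rabs (snd z) ^ 2) = sqrt (fst z ^ 2 + snd z ^ 2)).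
  now rewrite !pow2_abs.
Qed.

Lemma cis_plus (a b : R) : cis (a + b) = (cis a * cis b)%C.
Proof.
  unfold cis, Cmult; simpl. rewrite cos_plus, sin_plus. f_equal. ring.
Qed.

Lemma cis_0 : cis 0 = 1%C.
Proof. unfold cis. now rewrite cos_0, sin_0. Qed.

Lemma cis_opp_r (a : R) : (cis a * cis (- a) = 1)%C.
Proof. rewrite <- cis_plus, Rplus_opp_r. apply cis_0. Qed.

Lemma Cmod_cis (a : R) : Cmod (cis a) = 1.
Proof.
  unfold Cmod, cis; simpl. rewrite !Rmult_1_r, Rplus_comm.
  change (sqrt (Rsqr (sin a) + Rsqr (cos a)) = 1). rewrite sin2_cos2. apply sqrt_1.
Qed.

Lemma cis_neq_0 (a : R) : cis a <> 0%C.
Proof. intros H. pose proof (Cmod_cis a). rewrite H, Cmod_0 in *. lra. Qed.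

Lemma Cmod_cis_mult (a : R) (z : C) : Cmod (cis a * z)%C = Cmod z.
Proof. rewrite Cmod_mult, Cmod_cis. ring. Qed.

Lemma Cmod_mult_cis (a : R) (z : C) : Cmod (z * cis a)%C = Cmod z.
Proof. rewrite Cmod_mult, Cmod_cis. ring. Qed.

Lemma is_derive_C_intro (p : R -> C) (t : R) (l : C) :
  is_derive (fun s => Re (p s)) t (Re l) -> is_derive (fun s => Im (p s)) t (Im l) ->
  is_derive_C p t l.
Proof.
  intros Hr Hi. unfold is_derive_C, is_derive in *.
  apply filterdiff_ext with (fun s => (Re (p s), Im (p s))).
  { intros s. now destruct (p s). }
  apply (filterdiff_ext_lin _ (fun y : R => (scal y (Re l), scal y (Im l)))); [| reflexivity].
  apply (filterdiff_comp_2 (fun s => Re (p s)) (fun s => Im (p s)) (fun a b => (a, b))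
     (fun y : R => scal y (Re l)) (fun y : R => scal y (Im l)) (fun a b => (a, b)) Hr Hi).
  apply (filterdiff_ext (fun x => x)). { intros []; reflexivity. }
  apply (filterdiff_ext_lin _ (fun x => x)). { apply filterdiff_id. }
  intros []; reflexivity.
Qed.

Lemma is_derive_C_Re (p : R -> C) (t : R) (l : C) :
  is_derive_C p t l -> is_derive (fun s => Re (p s)) t (Re l).
Proof.
  intros H. unfold is_derive_C, is_derive in *.
  apply (filterdiff_comp' p (fun z : C => fst z) t _ (fun z : C => fst z)) in H.
  - exact H.
  - apply filterdiff_linear, is_linear_fst.
Qed.

Lemma is_derive_C_Im (p : R -> C) (t : R) (l : C) :
  is_derive_C p t l -> is_derive (fun s => Im (p s)) t (Im l).
Proof.
  intros H. unfold is_derive_C, is_derive in *.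
  apply (filterdiff_comp' p (fun z : C => snd z) t _ (fun z : C => snd z)) in H.
  - exact H.
  - apply filterdiff_linear, is_linear_snd.
Qed.

Lemma is_derive_C_continuous (p : R -> C) (t : R) (l : C) :
  is_derive_C p t l -> continuous_C p t.
Proof. intros H. apply (ex_derive_continuous (V := C_R_NormedModule)). now exists l. Qed.

Lemma is_derive_C_cis (c : C) (t : R) :
  is_derive_C (fun s => c * cis s)%C t (c * (Ci * cis t))%C.
Proof.
  apply is_derive_C_intro; unfold cis; simpl; auto_derive; auto; ring.
Qed.

Lemma continuous_C_intro (f : R -> C) (t : R) :
  continuous (fun s => Re (f s)) t -> continuous (fun s => Im (f s)) t -> continuous_C f t.
Proof.
  intros Hr Hi.
  apply (continuous_ext (fun s => (Re (f s), Im (f s)))).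
  { intros s. now destruct (f s). }
  apply (continuous_comp_2 (fun s => Re (f s)) (fun s => Im (f s)) (fun a b => (a, b)) t Hr Hi).
  apply (continuous_ext (fun x => x)). { intros []; reflexivity. }
  apply continuous_id.
Qed.

Lemma continuous_C_Re (f : R -> C) (t : R) :
  continuous_C f t -> continuous (fun s => Re (f s)) t.
Proof.
  intros H. apply (continuous_comp f (fun z : C => fst z) t H).
  destruct (f t). apply continuous_fst.
Qed.

Lemma continuous_C_Im (f : R -> C) (t : R) :
  continuous_C f t -> continuous (fun s => Im (f s)) t.
Proof.
  intros H. apply (continuous_comp f (fun z : C => snd z) t H).
  destruct (f t). apply continuous_snd.
Qed.

Lemma continuous_C_mult (f g : R -> C) (t : R) :
  continuous_C f t -> continuous_C g t -> continuous_C (fun s => f s * g s)%C t.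
Proof.
  intros Hf Hg. pose proof (continuous_C_Re _ _ Hf). pose proof (continuous_C_Im _ _ Hf).
  pose proof (continuous_C_Re _ _ Hg). pose proof (continuous_C_Im _ _ Hg).
  apply continuous_C_intro; simpl.
  - apply (continuous_minus (fun s => Re (f s) * Re (g s)) (fun s => Im (f s) * Im (g s)));
      now apply (continuous_mult (K := R_AbsRing)).
  - apply (continuous_plus (fun s => Re (f s) * Im (g s)) (fun s => Im (f s) * Re (g s)));
      now apply (continuous_mult (K := R_AbsRing)).
Qed.

Lemma continuous_C_plus (f g : R -> C) (t : R) :
  continuous_C f t -> continuous_C g t -> continuous_C (fun s => f s + g s)%C t.
Proof. apply (continuous_plus (V := C_R_NormedModule) f g t). Qed.

Lemma continuous_C_cis (t : R) : continuous_C cis t.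
Proof.
  apply (is_derive_C_continuous _ _ (1 * (Ci * cis t))%C).
  apply (is_derive_ext (V := C_R_NormedModule) (fun s => 1 * cis s)%C).
  - intros s. apply Cmult_1_l.
  - apply is_derive_C_cis.
Qed.

Lemma is_RInt_C_mult (c : C) (f : R -> C) (a b : R) (l : C) :
  is_RInt_C f a b l -> is_RInt_C (fun s => c * f s)%C a b (c * l)%C.
Proof.
  intros H. pose proof (is_RInt_fct_extend_fst f a b l H) as Hr.
  pose proof (is_RInt_fct_extend_snd f a b l H) as Hi.
  apply is_RInt_fct_extend_pair; simpl.
  - apply (is_RInt_minus (fun s => fst c * fst (f s)) (fun s => snd c * snd (f s)));
      now apply (is_RInt_scal (V := R_NormedModule)).
  - apply (is_RInt_plus (fun s => fst c * snd (f s)) (fun s => snd c * fst (f s)));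
      now apply (is_RInt_scal (V := R_NormedModule)).
Qed.

Lemma is_RInt_C_shift (f : R -> C) (a b T : R) (l : C) :
  is_RInt_C f (a + T) (b + T) l -> is_RInt_C (fun s => f (s + T)) a b l.
Proof.
  intros H. apply (is_RInt_ext (fun s => scal 1 (f (1 * s + T)))).
  - intros s _. rewrite Rmult_1_l. apply (scal_one (V := C_R_NormedModule)).
  - apply (is_RInt_comp_lin (V := C_R_NormedModule)). now rewrite !Rmult_1_l.
Qed.

Lemma is_RInt_C_eq (f g : R -> C) (a b : R) (l m : C) :
  (forall s, f s = g s) -> l = m -> is_RInt_C f a b l -> is_RInt_C g a b m.
Proof. intros H -> Hf. apply (is_RInt_ext f); auto. Qed.

Lemma is_RInt_C_continuous (f : R -> C) (a b : R) :
  (forall s, continuous_C f s) -> exists l : C, is_RInt_C f a b l.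
Proof.
  intros H. apply (ex_RInt_continuous (V := C_R_CompleteNormedModule)). auto.
Qed.

Lemma is_RInt_C_uniq (f : R -> C) (a b : R) (l m : C) :
  is_RInt_C f a b l -> is_RInt_C f a b m -> l = m.
Proof.
  intros Hl Hm.
  rewrite <- (is_RInt_unique (V := C_R_CompleteNormedModule) f a b l Hl).
  apply (is_RInt_unique (V := C_R_CompleteNormedModule) f a b m Hm).
Qed.

Lemma is_RInt_C_of_derive (y g : R -> C) (a b : R) :
  (forall t, is_derive_C y t (g t)) -> (forall t, continuous_C g t) ->
  is_RInt_C g a b (y b - y a)%C.
Proof.
  intros Hy Hg. apply (is_RInt_derive (V := C_R_CompleteNormedModule) y g); auto.
  intros t _. apply Hy.
Qed.

Lemma is_derive_C_of_RInt (y g : R -> C) (c : C) (B t : R) :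
  (forall s, Rabs s <= B -> is_RInt_C g 0 s (y s - c)%C) ->
  (forall s, continuous_C g s) -> Rabs t < B -> is_derive_C y t (g t).
Proof.
  intros Hy Hg Ht.
  assert (H : is_derive_C (fun s => y s - c)%C t (g t)).
  { apply (is_derive_RInt (V := C_R_NormedModule) g _ 0).
    - exists (mkposreal (B - Rabs t) (proj2 (Rlt_0_minus _ _) Ht)). intros s Hs. apply Hy.
      change (Rabs (s - t) < B - Rabs t) in Hs.
      assert (E : Rabs s <= Rabs (s - t) + Rabs t)
        by (pose proof (Rabs_triang_inv s t); lra). lra.
    - apply Hg. }
  apply (is_derive_ext (V := C_R_NormedModule) (fun s => (y s - c) + c)%C).
  - intros s. change (y s - c + c = y s)%C. ring.
  - replace (g t) with (g t + 0)%C by ring.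
    apply (is_derive_plus (V := C_R_NormedModule) (fun s => y s - c)%C (fun _ => c)).
    + exact H.
    + apply (is_derive_const (V := C_R_NormedModule)).
Qed.

(** * Twisted-periodic solutions of an equivariant equation *)

(** A solution with [y (t + T) = zeta * y t] satisfies
    [(zeta - 1) * y t = y (t + T) - y t], hence
    [y t = kappa * int_t^(t + T) F s (y s) ds] with [kappa = / (zeta - 1)].
    In this form no initial value occurs and the right-hand side is bounded by
    the size of [F], uniformly in time: every such solution is small, and the
    operator is a contraction. *)
Section RotatingWave.
Context (T r rho k : R) (F : R -> C -> C).
Let zeta := cis T.
Let kappa := (/ (zeta - 1))%C.
Context (HT : 0 <= T) (Hzeta : zeta <> 1%C) (Hk : 0 <= k)
  (Hrho : 0 <= rho) (Hr : 0 <= r)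
  (F_bounded : forall t y, Cmod (F t y) <= rho)
  (F_continuous : forall y : R -> C, (forall t, continuous_C y t) ->
     forall t, continuous_C (fun s => F s (y s)) t)
  (F_lipschitz : forall t x y, Cmod x <= r -> Cmod y <= r ->
     Cmod (F t x - F t y) <= k * Cmod (x - y))
  (F_equivariant : forall t y, F (t + T) (zeta * y)%C = (zeta * F t y)%C)
  (small_rho : T * (Cmod kappa * rho) <= r)
  (small_k : T * (Cmod kappa * k) <= 1 / 2).

Lemma kappa_spec : (kappa * (zeta - 1) = 1)%C.
Proof.
  unfold kappa. apply Cinv_l. intros H. apply Hzeta.
  replace zeta with (zeta - 1 + 1)%C by ring. rewrite H. ring.
Qed.

Let integral_solution (y : R -> C) :=
  forall t, is_RInt_C (fun s => kappa * F s (y s))%C t (t + T) (minus (y t) (RtoC 0)).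

Lemma wave_integral_solution (y : R -> C) :
  (forall t, is_derive_C y t (F t (y t))) -> (forall t, y (t + T)%R = (zeta * y t)%C) ->
  (forall t, continuous_C y t) /\ integral_solution y /\ forall t, Cmod (y t) <= r.
Proof.
  intros Hd Hy.
  assert (Hc : forall t, continuous_C y t)
    by (intros t; eapply is_derive_C_continuous; apply Hd).
  assert (Hi : integral_solution y).
  { intros t. eapply is_RInt_C_eq;
      [reflexivity | | apply is_RInt_C_mult, (is_RInt_C_of_derive y); auto].
    rewrite Hy. change (kappa * (zeta * y t - y t) = y t - 0)%C.
    replace (kappa * (zeta * y t - y t))%C with (kappa * (zeta - 1) * y t)%C by ring.
    rewrite kappa_spec. ring. }
  repeat split; auto. intros t.
  apply Rle_trans with (2 := small_rho). rewrite <- norm_C.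
  replace (y t) with (minus (y t) (RtoC 0) : C_R_NormedModule)
    by (change (y t - 0 = y t)%C; ring).
  refine (is_RInt_norm_le _ _ _ _ _ _ _ _ _ (Hi t)).
  - replace (t + T - t) with T by ring. rewrite Rabs_pos_eq; lra.
  - apply Rmult_le_pos; [apply Cmod_ge_0 | auto].
  - intros s _. rewrite norm_C, Cmod_mult.
    apply Rmult_le_compat_l; [apply Cmod_ge_0 | auto].
Qed.

Lemma integral_solution_unique (x y : R -> C) :
  (forall t, Cmod (x t) <= r) -> (forall t, Cmod (y t) <= r) ->
  integral_solution x -> integral_solution y -> forall t, x t = y t.
Proof.
  intros Hxr Hyr Hx Hy t. apply (eq_of_norm_minus (V := C_R_NormedModule)).
  replace 0 with (2 * 0) by ring.
  refine (integral_equation_stable (V := C_R_CompleteNormedModule) (fun _ => True)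
    (fun _ => RtoC 0) (fun _ => RtoC 0) x y (fun t => t) (fun t => t + T)
    (fun s z => kappa * F s z)%C T (Cmod kappa * k) r 0 _ _ _ _ _ small_k _ _ _ _ _ t I).
  - intros s _. replace (s + T - s) with T by ring. rewrite Rabs_pos_eq; lra.
  - apply Rmult_le_pos; [apply Cmod_ge_0 | auto].
  - lra.
  - auto.
  - intros s u w. rewrite !norm_C. intros Hu Hw.
    change (Cmod (kappa * F s u - kappa * F s w) <= Cmod kappa * k * Cmod (u - w)).
    replace (kappa * F s u - kappa * F s w)%C with (kappa * (F s u - F s w))%C by ring.
    rewrite Cmod_mult, Rmult_assoc. apply Rmult_le_compat_l; [apply Cmod_ge_0 | auto].
  - intros s _. rewrite norm_C. auto.
  - intros s _. rewrite norm_C. auto.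
  - intros s _. apply Hx.
  - intros s _. apply Hy.
  - intros s _. rewrite (norm_minus_diag (V := C_R_NormedModule)). lra.
Qed.

Lemma rotating_wave_unique (x y : R -> C) :
  (forall t, is_derive_C x t (F t (x t))) -> (forall t, x (t + T)%R = (zeta * x t)%C) ->
  (forall t, is_derive_C y t (F t (y t))) -> (forall t, y (t + T)%R = (zeta * y t)%C) ->
  forall t, x t = y t.
Proof.
  intros Hx Hxz Hy Hyz.
  destruct (wave_integral_solution x Hx Hxz) as (_ & Hxi & Hxr).
  destruct (wave_integral_solution y Hy Hyz) as (_ & Hyi & Hyr).
  now apply integral_solution_unique.
Qed.

(** The twisted shift [t |-> / zeta * y (t + T)] of a fixed point is again a
    fixed point, by equivariance of [F]; uniqueness then yields the symmetry,
    and the symmetry turns the integral equation back into the differential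
    one. *)
Lemma rotating_wave_exists :
  exists y : R -> C, (forall t, is_derive_C y t (F t (y t))) /\
    (forall t, y (t + T)%R = (zeta * y t)%C) /\ forall t, Cmod (y t) <= r.
Proof.
  assert (HK : 0 <= Cmod kappa) by apply Cmod_ge_0.
  destruct (integral_equation_solvable (V := C_R_CompleteNormedModule)
    (fun _ => RtoC 0) (fun t => t) (fun t => t + T) (fun s z => kappa * F s z)%C
    T (Cmod kappa * rho) (Cmod kappa * k) r) as (y & Hy & Hyr & Hi); auto; try (change (R -> C) in (type of y)).
  - intros t. apply continuous_const.
  - intros t. apply continuous_id.
  - intros t. apply (continuous_plus (fun t : R => t) (fun _ => T));
      [apply continuous_id | apply continuous_const].
  - intros t. replace (t + T - t) with T by ring. rewrite Rabs_pos_eq; lra.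
  - now apply Rmult_le_pos.
  - now apply Rmult_le_pos.
  - intros x Hx _ s. apply continuous_C_mult; [apply continuous_const | now apply F_continuous].
  - intros s x _. rewrite norm_C, Cmod_mult. now apply Rmult_le_compat_l.
  - intros s u w. rewrite !norm_C. intros Hu Hw.
    change (Cmod (kappa * F s u - kappa * F s w) <= Cmod kappa * k * Cmod (u - w)).
    replace (kappa * F s u - kappa * F s w)%C with (kappa * (F s u - F s w))%C by ring.
    rewrite Cmod_mult, Rmult_assoc. now apply Rmult_le_compat_l; auto.
  - intros t. rewrite norm_C, Cmod_0. lra.
  - assert (Hyr' : forall t, Cmod (y t) <= r)
      by (intros t; rewrite <- norm_C; apply Hyr).
    assert (Hz0 : zeta <> 0%C) by apply cis_neq_0.
    assert (Hrot : forall t, y (t + T)%R = (zeta * y t)%C).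
    { intros t.
      assert (E : y t = (/ zeta * y (t + T)%R)%C).
      { apply (integral_solution_unique y (fun t => / zeta * y (t + T)%R)%C); auto.
        - intros s. unfold zeta.
          rewrite Cmod_mult, Cmod_inv by apply cis_neq_0. rewrite Cmod_cis, Rinv_1, Rmult_1_l.
          apply Hyr'.
        - intros s. specialize (Hi (s + T)).
          apply (is_RInt_C_shift _ s (s + T) T) in Hi.
          apply (is_RInt_C_mult (/ zeta)) in Hi.
          revert Hi. apply is_RInt_C_eq.
          + intros q. replace (y (q + T)%R) with (zeta * (/ zeta * y (q + T)%R))%C at 1
              by (field; exact Hz0).
            rewrite F_equivariant. field. exact Hz0.
          + change (/ zeta * (y (s + T)%R - 0) = / zeta * y (s + T)%R - 0)%C. ring. }
      rewrite E. field. exact Hz0. }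
    exists y. split; [| now split]. intros t.
    set (g := fun s => F s (y s)).
    assert (Hg : forall s, continuous_C g s) by (apply F_continuous; exact Hy).
    assert (HY : forall s, exists l, is_RInt_C g 0 s l)
      by (intros s; now apply is_RInt_C_continuous).
    destruct (functional_choice _ HY) as [Y HY'].
    (* [y] differs from the primitive [Y] of [F s (y s)] by a constant *)
    apply (is_derive_C_of_RInt y g (kappa * Y T)%C (Rabs t + 1)); [| exact Hg | lra].
    intros s _. eapply is_RInt_C_eq; [reflexivity | | apply HY'].
    assert (H1 : is_RInt_C g 0 (s + T) (Y T + zeta * Y s)%C).
    { apply (is_RInt_Chasles (V := C_R_NormedModule) g 0 T); [apply HY' |].
      assert (H2 : is_RInt_C (fun q => g (q + T)) 0 s (zeta * Y s)%C).
      { eapply is_RInt_C_eq; [| reflexivity | apply is_RInt_C_mult, HY'].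
        intros q. unfold g. now rewrite Hrot, F_equivariant. }
      replace 0 with (T + - T) in H2 at 1 by ring.
      replace s with (s + T + - T) in H2 by ring.
      apply is_RInt_C_shift in H2. revert H2. apply is_RInt_C_eq; [| f_equal; f_equal; f_equal; ring].
      intros q. f_equal. ring. }
    assert (H2 : (kappa * (Y (s + T)%R - Y s) = y s)%C).
    { apply (is_RInt_C_uniq (fun q => kappa * g q)%C s (s + T)).
      - apply is_RInt_C_mult.
        replace (Y (s + T)%R - Y s)%C with (- Y s + Y (s + T)%R)%C by ring.
        apply (is_RInt_Chasles (V := C_R_NormedModule) g s 0); [| apply HY'].
        apply (is_RInt_swap (V := C_R_NormedModule)), HY'.
      - eapply is_RInt_C_eq; [reflexivity | | apply (Hi s)].
        change (y s - 0 = y s)%C. ring. }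
    rewrite <- H2, (is_RInt_C_uniq _ _ _ _ _ (HY' (s + T)) H1).
    replace (kappa * (Y T + zeta * Y s - Y s) - kappa * Y T)%C
      with (kappa * (zeta - 1) * Y s)%C by ring.
    rewrite kappa_spec. symmetry. apply Cmult_1_l.
Qed.
End RotatingWave.

(** * Local expansion of a smooth map of the plane *)

Lemma scal_C (a : R) (z : C) : @scal R_AbsRing C_R_NormedModule a z = (a * z)%C.
Proof.
  destruct z as [x y]. unfold Cmult, RtoC; simpl.
  change ((a * x, a * y) = (a * x - 0 * y, a * y + 0 * x)). f_equal; ring.
Qed.

Lemma Cmod_le_abs (z : C) : Cmod z <= Rabs (Re z) + Rabs (Im z).
Proof.
  destruct z as [x y]; simpl.
  replace (x, y) with (RtoC x + Ci * RtoC y)%C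
    by (unfold Cplus, Cmult, RtoC, Ci; simpl; f_equal; ring).
  eapply Rle_trans; [apply Cmod_triangle |].
  rewrite Cmod_mult, !Cmod_R.
  replace (Cmod Ci) with 1; [lra |].
  unfold Cmod, Ci; simpl. replace (0 * (0 * 1) + 1 * (1 * 1)) with 1 by ring.
  now rewrite sqrt_1.
Qed.

Lemma im_le_Cmod (z : C) : Rabs (Im z) <= Cmod z.
Proof. eapply Rle_trans; [apply Rmax_r | apply Rmax_Cmod]. Qed.

(** The factor [2] pays for treating the two real components separately. *)
Lemma mean_value_inequality_C (g dg : R -> C) (B : R) :
  (forall s, 0 <= s <= 1 -> is_derive_C g s (dg s)) ->
  (forall s, 0 <= s <= 1 -> Cmod (dg s) <= B) ->
  Cmod (g 1 - g 0) <= 2 * B.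
Proof.
  intros Hg HB.
  assert (H01 : Rmin 0 1 = 0 /\ Rmax 0 1 = 1)
    by (split; [apply Rmin_left | apply Rmax_right]; lra).
  destruct H01 as [Hm HM].
  assert (Hre : Rabs (Re (g 1) - Re (g 0)) <= B).
  { destruct (MVT_gen (fun s => Re (g s)) 0 1 (fun s => Re (dg s))) as (c & Hc & E);
      rewrite ?Hm, ?HM in *.
    - intros s Hs. apply is_derive_C_Re, Hg. lra.
    - intros s Hs. apply continuity_pt_filterlim.
      apply (ex_derive_continuous (V := R_NormedModule)).
      exists (Re (dg s)). now apply is_derive_C_Re, Hg.
    - rewrite E. replace (Re (dg c) * (1 - 0)) with (Re (dg c)) by ring.
      eapply Rle_trans; [apply re_le_Cmod | now apply HB]. }
  assert (Him : Rabs (Im (g 1) - Im (g 0)) <= B).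
  { destruct (MVT_gen (fun s => Im (g s)) 0 1 (fun s => Im (dg s))) as (c & Hc & E);
      rewrite ?Hm, ?HM in *.
    - intros s Hs. apply is_derive_C_Im, Hg. lra.
    - intros s Hs. apply continuity_pt_filterlim.
      apply (ex_derive_continuous (V := R_NormedModule)).
      exists (Im (dg s)). now apply is_derive_C_Im, Hg.
    - rewrite E. replace (Im (dg c) * (1 - 0)) with (Im (dg c)) by ring.
      eapply Rle_trans; [apply im_le_Cmod | now apply HB]. }
  eapply Rle_trans; [apply Cmod_le_abs |].
  change (Rabs (Re (g 1) - Re (g 0)) + Rabs (Im (g 1) - Im (g 0)) <= 2 * B). lra.
Qed.

Lemma segment_in_ball (w0 w w' : C) (r s : R) :
  0 <= s <= 1 -> Cmod (w - w0) <= r -> Cmod (w' - w0) <= r ->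
  Cmod (w + s * (w' - w) - w0) <= r.
Proof.
  intros Hs Hw Hw'.
  replace (w + s * (w' - w) - w0)%C with (RtoC (1 - s) * (w - w0) + RtoC s * (w' - w0))%C
    by (rewrite RtoC_minus; ring).
  eapply Rle_trans; [apply Cmod_triangle |]. rewrite !Cmod_mult, !Cmod_R.
  rewrite !Rabs_pos_eq by lra.
  assert ((1 - s) * Cmod (w - w0) <= (1 - s) * r) by (apply Rmult_le_compat_l; lra).
  assert (s * Cmod (w' - w0) <= s * r) by (apply Rmult_le_compat_l; lra).
  lra.
Qed.

Notation C_times_R := (prod_NormedModule R_AbsRing C_R_NormedModule R_NormedModule).

Lemma is_derive_along_line (f : C_times_R -> C_R_NormedModule) (l : C_times_R -> C_R_NormedModule)
    (w d : C) (mu s : R) :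
  filterdiff f (locally ((w + s * d)%C, mu)) l ->
  is_derive_C (fun q => f ((w + q * d)%C, mu)) s (l (d, 0)).
Proof.
  intros Hf.
  assert (Hl : filterdiff (fun q : R => (((w + q * d)%C, mu) : C_times_R)) (locally s)
                 (fun q : R => ((scal q d, 0) : C_times_R))).
  { apply (filterdiff_ext (fun q : R => plus ((w, mu) : C_times_R) (scal q d, 0))).
    - intros q. change (((w + @scal R_AbsRing C_R_NormedModule q d)%C, mu + 0) = ((w + q * d)%C, mu)).
      rewrite scal_C. f_equal. ring.
    - apply (filterdiff_ext_lin _ (fun q : R => plus (zero : C_times_R) (scal q d, 0))).
      + apply filterdiff_plus_fct.
        * apply filterdiff_const.
        * apply (filterdiff_linear (fun q : R => ((scal q d, 0) : C_times_R))).
          apply (is_linear_prod (fun q : R => scal q d) (fun q : R => 0)).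
          -- apply (is_linear_scal_l (V := C_R_NormedModule)).
          -- exact (is_linear_zero (K := R_AbsRing) (V := R_NormedModule)).
      + intros q. apply plus_zero_l. }
  unfold is_derive_C, is_derive.
  apply (filterdiff_ext_lin _ (fun q : R => l (scal q d, 0))).
  - apply (filterdiff_comp' (fun q : R => (((w + q * d)%C, mu) : C_times_R)) f s _ l Hl Hf).
  - intros q. rewrite <- (linear_scal l (proj1 Hf)). f_equal.
    change ((scal q d, 0) = (scal q d, q * 0)). f_equal. ring.
Qed.

Lemma linear_partials (l : C_times_R -> C_R_NormedModule) (h : C) :
  is_linear l ->
  l (h, 0) = (Re h * l (RtoC 1, 0) + Im h * l (Ci, 0))%C.
Proof.
  intros Hl. rewrite <- !scal_C, <- !(linear_scal l Hl).
  change (l (h, 0) = plus (l (scal (Re h) ((RtoC 1, 0) : C_times_R))) (l (scal (Im h) ((Ci, 0) : C_times_R)))).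
  rewrite <- (linear_plus l Hl). f_equal. destruct h as [x y].
  change ((x, y, 0) = ((x * 1 + y * 0, x * 0 + y * 1), x * 0 + y * 0)).
  repeat f_equal; ring.
Qed.

Lemma continuous_uniformly_near (g : C_times_R -> C_R_NormedModule) (w0 : C) (eta : R) :
  0 < eta -> continuous g (w0, 0) ->
  exists r, 0 < r /\ forall w mu, Cmod (w - w0) <= r -> Rabs mu <= r ->
    Cmod (g (w, mu) - g (w0, 0)) <= eta.
Proof.
  intros He Hg. destruct (norm_of_continuous g (w0, 0) eta Hg He) as [e Hb].
  pose proof (cond_pos e) as He0.
  exists (e / 2). split; [lra |]. intros w mu Hw Hmu.
  specialize (Hb (w, mu)). rewrite norm_C in Hb. apply Rlt_le, Hb. split.
  - apply (norm_compat1 (V := C_R_NormedModule)). rewrite norm_C.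
    change (Cmod (w - w0) < e). lra.
  - change (Rabs (mu - 0) < e). rewrite Rminus_0_r. lra.
Qed.

(** The two partial derivatives in the first variable are bounded near
    [(w0, 0)] because they are continuous there. *)
Lemma C1_locally_lipschitz (f : C_times_R -> C_R_NormedModule) (delta : posreal) (w0 : C) :
  Ck_on 1 (fun x => Rabs (snd x) < delta) f ->
  exists r K, 0 < r /\ 0 <= K /\ forall mu w w', Rabs mu <= r ->
    Cmod (w - w0) <= r -> Cmod (w' - w0) <= r ->
    Cmod (f (w', mu) - f (w, mu)) <= K * Cmod (w' - w).
Proof.
  intros (df & Hdf & Hc).
  assert (H0 : Rabs (snd (w0, 0)) < delta) by (simpl; rewrite Rabs_R0; apply cond_pos).
  destruct (continuous_uniformly_near (fun x => df x (RtoC 1, 0)) w0 1 Rlt_0_1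
              (Hc _ _ H0)) as (r1 & Hr1 & H1).
  destruct (continuous_uniformly_near (fun x => df x (Ci, 0)) w0 1 Rlt_0_1
              (Hc _ _ H0)) as (r2 & Hr2 & H2).
  set (M1 := Cmod (df (w0, 0) (RtoC 1, 0)) + 1).
  set (M2 := Cmod (df (w0, 0) (Ci, 0)) + 1).
  set (r := Rmin (Rmin r1 r2) (delta / 2)).
  assert (Hr : 0 < r) by (pose proof (cond_pos delta); repeat apply Rmin_pos; lra).
  assert (Hrr : r <= r1 /\ r <= r2 /\ r <= delta / 2).
  { unfold r. pose proof (Rmin_l (Rmin r1 r2) (delta / 2)).
    pose proof (Rmin_r (Rmin r1 r2) (delta / 2)).
    pose proof (Rmin_l r1 r2). pose proof (Rmin_r r1 r2). lra. }
  exists r, (2 * (M1 + M2)). split; [exact Hr |].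
  assert (HM : 0 <= M1 /\ 0 <= M2).
  { unfold M1, M2. pose proof (Cmod_ge_0 (df (w0, 0) (RtoC 1, 0))).
    pose proof (Cmod_ge_0 (df (w0, 0) (Ci, 0))). lra. }
  split; [lra |]. intros mu w w' Hmu Hw Hw'.
  set (d := (w' - w)%C).
  assert (Hmv : Cmod (f ((w + 1%R * d)%C, mu) - f ((w + 0%R * d)%C, mu))
                <= 2 * ((M1 + M2) * Cmod d)).
  { apply (mean_value_inequality_C (fun s => f ((w + s * d)%C, mu))
             (fun s => df ((w + s * d)%C, mu) (d, 0))).
    - intros s Hs. apply is_derive_along_line, Hdf. simpl.
      pose proof (cond_pos delta). lra.
    - intros s Hs.
      assert (Hws : Cmod (w + s * d - w0) <= r) by now apply segment_in_ball.
      rewrite linear_partials by (apply Hdf; simpl; pose proof (cond_pos delta); lra).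
      assert (B1 : Cmod (df ((w + s * d)%C, mu) (RtoC 1, 0)) <= M1).
      { replace (df ((w + s * d)%C, mu) (RtoC 1, 0)) with
          ((df ((w + s * d)%C, mu) (RtoC 1, 0) - df (w0, 0) (RtoC 1, 0))
             + df (w0, 0) (RtoC 1, 0))%C by ring.
        eapply Rle_trans; [apply Cmod_triangle |]. rewrite Rplus_comm.
        apply Rplus_le_compat_l, H1; lra. }
      assert (B2 : Cmod (df ((w + s * d)%C, mu) (Ci, 0)) <= M2).
      { replace (df ((w + s * d)%C, mu) (Ci, 0)) with
          ((df ((w + s * d)%C, mu) (Ci, 0) - df (w0, 0) (Ci, 0))
             + df (w0, 0) (Ci, 0))%C by ring.
        eapply Rle_trans; [apply Cmod_triangle |]. rewrite Rplus_comm.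
        apply Rplus_le_compat_l, H2; lra. }
      eapply Rle_trans; [apply Cmod_triangle |]. rewrite !Cmod_mult, !Cmod_R.
      pose proof (re_le_Cmod d). pose proof (im_le_Cmod d).
      rewrite Rmult_plus_distr_r, (Rmult_comm M1), (Rmult_comm M2).
      apply Rplus_le_compat; apply Rmult_le_compat; auto using Rabs_pos, Cmod_ge_0. }
  replace (w + 1%R * d)%C with w' in Hmv by (unfold d; ring).
  replace (w + 0%R * d)%C with w in Hmv by ring. lra.
Qed.

Lemma Derive_C_unique (p : R -> C) (t : R) (l : C) : is_derive_C p t l -> Derive_C p t = l.
Proof.
  intros H. unfold Derive_C.
  rewrite (surjective_pairing l). f_equal; apply is_derive_unique.
  - now apply is_derive_C_Re.
  - now apply is_derive_C_Im.
Qed.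

Lemma continuous_along_curve (f : C_times_R -> C_R_NormedModule) (w : R -> C) (mu t : R) :
  (forall z, continuous f (z, mu)) -> continuous_C w t ->
  continuous_C (fun s => f (w s, mu)) t.
Proof.
  intros Hf Hw.
  apply (continuous_comp_2 w (fun _ : R => mu) (fun (z : C) (m : R) => f (z, m)) t Hw).
  - apply continuous_const.
  - apply (continuous_ext f); [now intros [] | apply Hf].
Qed.

(** [D w mu] is the real derivative of [f] in its first argument. Its
    complex-linear part at [(w0, 0)] is the Wirtinger derivative; [beta] is the
    conjugate one. The partial derivatives are themselves [C^1], hence locally
    Lipschitz, which gives a quadratic Taylor remainder. *)
Lemma local_linearization (f : C -> R -> C) (delta : posreal) (w0 : C) :
  @smooth_on C_times_R C_R_NormedModule (fun x => Rabs (snd x) < delta)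
    (fun x => f (fst x) (snd x)) ->
  exists (D : C -> R -> C -> C) (beta : C) (r K : R),
    0 < r /\ 0 <= K /\
    (forall w mu h k, D w mu (h + k)%C = (D w mu h + D w mu k)%C) /\
    (forall w mu (a : R) h, D w mu (a * h)%C = (a * D w mu h)%C) /\
    (forall mu, Rabs mu <= r ->
      (forall (w : R -> C) t, continuous_C w t -> continuous_C (fun s => f (w s) mu) t) /\
      (forall (w k : R -> C) t, continuous_C w t -> continuous_C k t ->
         continuous_C (fun s => D (w s) mu (k s)) t) /\
      forall w w', Cmod (w - w0) <= r -> Cmod (w' - w0) <= r ->
        Cmod (f w' mu - f w mu) <= K * Cmod (w' - w) /\
        Cmod (f w' mu - f w mu - D w mu (w' - w)%C) <= K * Cmod (w' - w) ^ 2) /\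
    (forall eta, 0 < eta -> exists s, 0 < s /\ forall w mu h,
       Cmod (w - w0) <= s -> Rabs mu <= s ->
       Cmod (D w mu h - (wirtinger (fun z => f z 0) w0 * h + beta * Cconj h)) <= eta * Cmod h).
Proof.
  intros Hs. pose proof (cond_pos delta) as Hdel.
  destruct (C1_locally_lipschitz _ delta w0 (Hs 1%nat)) as (r0 & K0 & Hr0 & HK0 & Hlip0).
  destruct (Hs 2%nat) as (df & Hdf & Hdf1).
  destruct (C1_locally_lipschitz _ delta w0 (Hdf1 (RtoC 1, 0))) as (r1 & K1 & Hr1 & HK1 & Hlip1).
  destruct (C1_locally_lipschitz _ delta w0 (Hdf1 (Ci, 0))) as (r2 & K2 & Hr2 & HK2 & Hlip2).
  assert (Hcont : forall h z mu, Rabs mu < delta -> continuous (fun x => df x h) (z, mu)).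
  { intros h z mu Hmu. destruct (Hdf1 h) as (ddf & Hddf & _).
    apply filterdiff_continuous. exists (ddf (z, mu)). now apply Hddf. }
  set (d1 := fun w mu => df (w, mu) (RtoC 1, 0) : C).
  set (d2 := fun w mu => df (w, mu) (Ci, 0) : C).
  set (D := fun w mu h => (Re h * d1 w mu + Im h * d2 w mu)%C).
  set (r := Rmin (Rmin r0 (delta / 2)) (Rmin r1 r2)).
  assert (Hr : 0 < r) by (repeat apply Rmin_pos; lra).
  assert (Hrr : r <= r0 /\ r <= delta / 2 /\ r <= r1 /\ r <= r2).
  { unfold r. pose proof (Rmin_l (Rmin r0 (delta / 2)) (Rmin r1 r2)).
    pose proof (Rmin_r (Rmin r0 (delta / 2)) (Rmin r1 r2)).
    pose proof (Rmin_l r0 (delta / 2)). pose proof (Rmin_r r0 (delta / 2)).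
    pose proof (Rmin_l r1 r2). pose proof (Rmin_r r1 r2). lra. }
  assert (HDlip : forall mu w w' h, Rabs mu <= r -> Cmod (w - w0) <= r ->
            Cmod (w' - w0) <= r ->
            Cmod (D w' mu h - D w mu h) <= (K1 + K2) * Cmod (w' - w) * Cmod h).
  { intros mu w w' h Hmu Hw Hw'. unfold D.
    replace (Re h * d1 w' mu + Im h * d2 w' mu - (Re h * d1 w mu + Im h * d2 w mu))%C
      with (Re h * (d1 w' mu - d1 w mu) + Im h * (d2 w' mu - d2 w mu))%C by ring.
    eapply Rle_trans; [apply Cmod_triangle |]. rewrite !Cmod_mult, !Cmod_R.
    assert (B1 : Cmod (d1 w' mu - d1 w mu) <= K1 * Cmod (w' - w)) by (apply Hlip1; lra).
    assert (B2 : Cmod (d2 w' mu - d2 w mu) <= K2 * Cmod (w' - w)) by (apply Hlip2; lra).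
    replace ((K1 + K2) * Cmod (w' - w) * Cmod h)
      with (Cmod h * (K1 * Cmod (w' - w)) + Cmod h * (K2 * Cmod (w' - w))) by ring.
    apply Rplus_le_compat; apply Rmult_le_compat;
      auto using Rabs_pos, Cmod_ge_0, re_le_Cmod, im_le_Cmod. }
  set (beta := ((d1 w0 0%R + Ci * d2 w0 0%R) / 2)%C).
  set (K := Rmax K0 (2 * (K1 + K2))).
  exists D, beta, r, K. split; [exact Hr |]. split; [now apply Rle_trans with (2 := Rmax_l _ _) |].
  split. { intros w mu h k. unfold D. destruct h, k. simpl. rewrite !RtoC_plus. ring. }
  split. { intros w mu a h. unfold D. destruct h as [x y]. simpl.
    replace (a * x - 0 * y) with (a * x) by ring. replace (a * y + 0 * x) with (a * y) by ring.
    rewrite !RtoC_mult. ring. }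
  split.
  - intros mu Hmu. assert (Hmu' : Rabs mu < delta) by lra. repeat split.
    + intros w t Hw.
      apply (continuous_along_curve (fun x => f (fst x) (snd x)) w mu t); [| exact Hw].
      intros z. apply filterdiff_continuous. exists (df (z, mu)). now apply Hdf.
    + intros w k t Hw Hk. apply continuous_C_plus; apply continuous_C_mult.
      * apply continuous_C_intro; simpl; [now apply continuous_C_Re | apply continuous_const].
      * apply (continuous_along_curve (fun x => df x (RtoC 1, 0))); auto.
      * apply continuous_C_intro; simpl; [now apply continuous_C_Im | apply continuous_const].
      * apply (continuous_along_curve (fun x => df x (Ci, 0))); auto.
    + apply Rle_trans with (K0 * Cmod (w' - w)).
      * apply Hlip0; lra.
      * apply Rmult_le_compat_r; [apply Cmod_ge_0 | apply Rmax_l].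
    + set (d := (w' - w)%C).
      assert (Hmv : Cmod ((f (w + 1%R * d)%C mu - 1%R * D w mu d)
                          - (f (w + 0%R * d)%C mu - 0%R * D w mu d))
                    <= 2 * ((K1 + K2) * Cmod d * Cmod d)).
      { apply (mean_value_inequality_C (fun s => f (w + s * d)%C mu - s * D w mu d)%C
                 (fun s => D (w + s * d)%C mu d - D w mu d)%C).
        - intros s Hs01.
          apply (is_derive_minus (V := C_R_NormedModule)
                   (fun s => f (w + s * d)%C mu) (fun s => s * D w mu d)%C).
          + pose proof (Hdf ((w + s * d)%C, mu) Hmu') as Hd.
            pose proof (is_derive_along_line _ _ w d mu s Hd) as Hl.
            rewrite (linear_partials _ _ (proj1 Hd)) in Hl. exact Hl.
          + apply is_derive_C_intro; simpl; auto_derive; auto; ring.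
        - intros s Hs01.
          eapply Rle_trans; [apply HDlip; auto; now apply segment_in_ball |].
          apply Rmult_le_compat_r; [apply Cmod_ge_0 |].
          apply Rmult_le_compat_l; [lra |].
          replace (w + s * d - w)%C with (s * d)%C by ring.
          rewrite Cmod_mult, Cmod_R, Rabs_pos_eq by lra.
          rewrite <- (Rmult_1_l (Cmod d)) at 2.
          apply Rmult_le_compat_r; [apply Cmod_ge_0 | lra]. }
      replace (w + 1%R * d)%C with w' in Hmv by (unfold d; ring).
      replace (w + 0%R * d)%C with w in Hmv by ring.
      replace (f w' mu - 1%R * D w mu d - (f w mu - 0%R * D w mu d))%C
        with (f w' mu - f w mu - D w mu d)%C in Hmv by ring.
      eapply Rle_trans; [exact Hmv |].
      replace (2 * ((K1 + K2) * Cmod d * Cmod d)) with (2 * (K1 + K2) * Cmod d ^ 2) by ring.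
      apply Rmult_le_compat_r; [apply pow2_ge_0 | apply Rmax_r].
  - assert (H0 : Rabs 0 < delta) by (now rewrite Rabs_R0).
    assert (E1 : Derive_C (fun x => f (x, Im w0) 0) (Re w0) = d1 w0 0).
    { apply Derive_C_unique. unfold d1.
      assert (Ew : ((0, Im w0) + Re w0 * 1)%C = w0)
        by (destruct w0; unfold Cplus, Cmult, RtoC; simpl; f_equal; ring).
      pose proof (is_derive_along_line (fun x => f (fst x) (snd x)) (df (w0, 0))
        (0, Im w0) 1 0 (Re w0)) as Hl.
      rewrite Ew in Hl. specialize (Hl (Hdf (w0, 0) H0)). revert Hl.
      apply (is_derive_ext (V := C_R_NormedModule) (fun q => f ((0, Im w0) + q * 1)%C 0)).
      intros q. f_equal. unfold Cplus, Cmult, RtoC; simpl; f_equal; ring. }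
    assert (E2 : Derive_C (fun y => f (Re w0, y) 0) (Im w0) = d2 w0 0).
    { apply Derive_C_unique. unfold d2.
      assert (Ew : ((Re w0, 0) + Im w0 * Ci)%C = w0)
        by (destruct w0; unfold Cplus, Cmult, RtoC; simpl; f_equal; ring).
      pose proof (is_derive_along_line (fun x => f (fst x) (snd x)) (df (w0, 0))
        (Re w0, 0) Ci 0 (Im w0)) as Hl.
      rewrite Ew in Hl. specialize (Hl (Hdf (w0, 0) H0)). revert Hl.
      apply (is_derive_ext (V := C_R_NormedModule) (fun q => f ((Re w0, 0) + q * Ci)%C 0)).
      intros q. f_equal. unfold Cplus, Cmult, RtoC; simpl; f_equal; ring. }
    intros eta Heta.
    assert (Heta2 : 0 < eta / 2) by lra.
    destruct (continuous_uniformly_near (fun x => df x (RtoC 1, 0)) w0 (eta / 2) Heta2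
              (Hcont _ _ _ H0)) as (s1 & Hs1 & N1).
    destruct (continuous_uniformly_near (fun x => df x (Ci, 0)) w0 (eta / 2) Heta2
              (Hcont _ _ _ H0)) as (s2 & Hs2 & N2).
    exists (Rmin s1 s2). split; [now apply Rmin_pos |].
    pose proof (Rmin_l s1 s2). pose proof (Rmin_r s1 s2).
    intros w mu h Hw Hmu. unfold wirtinger. rewrite E1, E2.
    replace (D w mu h - ((d1 w0 0%R - Ci * d2 w0 0%R) / 2 * h + beta * Cconj h))%C
      with (Re h * (d1 w mu - d1 w0 0%R) + Im h * (d2 w mu - d2 w0 0%R))%C.
    2:{ unfold D, beta. generalize (d1 w mu) (d2 w mu) (d1 w0 0) (d2 w0 0).
        intros [] [] [] []. destruct h.
        unfold Cdiv, Cconj, Cminus, Copp, Cplus, Cmult, RtoC, Ci, Cinv; simpl.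
        f_equal; field. }
    eapply Rle_trans; [apply Cmod_triangle |]. rewrite !Cmod_mult, !Cmod_R.
    replace (eta * Cmod h) with (Cmod h * (eta / 2) + Cmod h * (eta / 2)) by field.
    apply Rplus_le_compat; apply Rmult_le_compat;
      auto using Rabs_pos, Cmod_ge_0, re_le_Cmod, im_le_Cmod.
    + apply N1; lra.
    + apply N2; lra.
Qed.

(** * Uniform bounds for periodic families *)

Lemma periodic_reduction (T : R) (Q : R -> Prop) :
  0 < T -> (forall t, Q t <-> Q (t + T)) -> (forall t, 0 <= t <= T -> Q t) -> forall t, Q t.
Proof.
  intros HT Hper H0.
  assert (Hn : forall (n : nat) t, Q t <-> Q (t + INR n * T)).
  { induction n as [| n IH]; intros t.
    - simpl. rewrite Rmult_0_l, Rplus_0_r. tauto.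
    - rewrite (IH t), (Hper (t + INR n * T)), S_INR.
      replace (t + INR n * T + T) with (t + (INR n + 1) * T) by ring. tauto. }
  assert (Hpos : forall t, 0 <= t -> Q t).
  { intros t Ht. destruct (nfloor_ex (t / T)) as [n [Hn1 Hn2]].
    { apply Rdiv_le_0_compat; lra. }
    replace t with (t - INR n * T + INR n * T) by ring. apply Hn, H0.
    apply (Rmult_le_compat_r T) in Hn1; [| lra].
    apply (Rmult_lt_compat_r T) in Hn2; [| lra].
    unfold Rdiv in Hn1, Hn2. rewrite Rmult_assoc, Rinv_l in Hn1, Hn2 by lra. lra. }
  intros t. destruct (Rle_dec 0 t) as [Ht | Ht]; [auto |].
  destruct (nfloor_ex (- t / T)) as [n [Hn1 Hn2]].
  { apply Rdiv_le_0_compat; lra. }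
  apply (Hn (S n)), Hpos. rewrite S_INR.
  apply (Rmult_lt_compat_r T) in Hn2; [| lra].
  unfold Rdiv in Hn2. rewrite Rmult_assoc, Rinv_l in Hn2 by lra. lra.
Qed.

(** Compactness of a period makes the bound uniform in time. *)
Lemma periodic_family_bounded (G : R -> R -> C) (T : R) (delta : posreal) :
  0 < T ->
  (forall t eps, Rabs eps < delta ->
     @continuous (prod_UniformSpace R_UniformSpace R_UniformSpace) C_UniformSpace
       (fun x => G (fst x) (snd x)) (t, eps)) ->
  (forall t eps, Rabs eps < delta -> G (t + T) eps = G t eps) ->
  exists d M, 0 < d /\ 0 <= M /\ d < delta /\
    forall t eps, Rabs eps <= d -> Cmod (G t eps) <= M.
Proof.
  intros HT Hc Hper. pose proof (cond_pos delta) as Hdel.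
  assert (H0 : Rabs 0 < delta) by now rewrite Rabs_R0.
  assert (Hloc : forall t, exists e : posreal, forall s eps,
            Rabs (s - t) < e -> Rabs eps < e -> Cmod (G s eps - G t 0) < 1).
  { intros t.
    assert (H1 : locally (T := C_R_NormedModule) (G t 0) (fun z => Cmod (z - G t 0) < 1)).
    { apply (locally_le_locally_norm (V := C_R_NormedModule)).
      exists (mkposreal 1 Rlt_0_1). intros z Hz. red in Hz. now rewrite norm_C in Hz. }
    destruct (Hc t 0 H0 _ H1) as [e He].
    exists e. intros s eps Hs Heps. apply (He (s, eps)). split; [exact Hs |].
    change (Rabs (eps - 0) < e). now rewrite Rminus_0_r. }
  destruct (functional_choice _ Hloc) as [e He].
  destruct (compactness_value_1d 0 T e) as [d Hd].
  assert (Hcmod : forall t, continuity_pt (fun s => Cmod (G s 0)) t).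
  { intros t. apply continuity_pt_filterlim.
    apply (continuous_ext (fun s => @norm R_AbsRing C_R_NormedModule (G s 0))).
    { intros s. apply norm_C. }
    apply (continuous_comp (fun s => G s 0) (@norm R_AbsRing C_R_NormedModule)).
    - apply (continuous_comp_2 (fun s : R => s) (fun _ : R => 0) G t);
        [apply continuous_id | apply continuous_const | now apply Hc].
    - apply (filterlim_norm (V := C_R_NormedModule)). }
  destruct (continuity_ab_maj (fun s => Cmod (G s 0)) 0 T) as (m & Hm & _); [lra | auto |].
  pose proof (cond_pos d) as Hd0.
  exists (Rmin (d / 2) (delta / 2)), (Cmod (G m 0) + 1).
  split; [apply Rmin_pos; lra |].
  split; [pose proof (Cmod_ge_0 (G m 0)); lra |].
  pose proof (Rmin_l (d / 2) (delta / 2)). pose proof (Rmin_r (d / 2) (delta / 2)).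
  split; [lra |]. intros t eps Heps. revert t.
  apply (periodic_reduction T _ HT).
  - intros t. rewrite Hper by lra. tauto.
  - intros t Ht. apply Rnot_lt_le. intros Hlt. apply (Hd t Ht).
    intros (s & Hs & Hts & Hds). apply (Rlt_not_le _ _ Hlt).
    specialize (He s t eps Hts ltac:(lra)). specialize (Hm s Hs).
    replace (G t eps) with ((G t eps - G s 0%R) + G s 0%R)%C by ring.
    pose proof (Cmod_triangle (G t eps - G s 0%R) (G s 0%R)). lra.
Qed.

(** * Spectrum of a real-linear map close to a conformal one *)

Definition real_linear (L : C -> C) : Prop :=
  (forall h k, L (h + k)%C = (L h + L k)%C) /\ (forall (a : R) h, L (a * h)%C = (a * L h)%C).

Lemma Cmod_sqr (z : C) : Cmod z ^ 2 = Re z ^ 2 + Im z ^ 2.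
Proof.
  unfold Cmod. rewrite <- Rsqr_pow2, Rsqr_sqrt; [reflexivity |].
  apply Rplus_le_le_0_compat; apply pow2_ge_0.
Qed.

Lemma real_linear_coordinates (L : C -> C) (x y : R) :
  real_linear L -> L (x, y) = (x * L 1 + y * L Ci)%C.
Proof.
  intros [Hp Hs]. rewrite <- !Hs, <- Hp. f_equal.
  unfold Cplus, Cmult, RtoC, Ci; simpl. f_equal; ring.
Qed.

(** The real and imaginary parts of a complex eigenvector form a pair of real
    vectors on which [L] scales the sum of squares by [Cmod lam ^ 2]. *)
Lemma eigenvalue_energy (L : C -> C) (lam : C) :
  real_linear L -> eigenvalue L lam ->
  exists h k : C, (h <> 0%C \/ k <> 0%C) /\
    Cmod (L h) ^ 2 + Cmod (L k) ^ 2 = Cmod lam ^ 2 * (Cmod h ^ 2 + Cmod k ^ 2).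
Proof.
  intros HL (x & y & Hxy & E1 & E2).
  exists (Re x, Re y), (Im x, Im y). split.
  - destruct (Ceq_dec (Re x, Re y) 0) as [H1 | H1]; [| now left].
    destruct (Ceq_dec (Im x, Im y) 0) as [H2 | H2]; [| now right].
    exfalso. apply Hxy. unfold RtoC in *. injection H1 as Hx Hy. injection H2 as Hx' Hy'.
    destruct x, y; simpl in *. now subst.
  - rewrite !real_linear_coordinates by exact HL. rewrite !Cmod_sqr. revert E1 E2.
    generalize (L 1) (L Ci). intros [a c] [b d].
    destruct x as [x1 x2], y as [y1 y2], lam as [l1 l2].
    unfold Cplus, Cmult, RtoC; simpl. intros E1 E2.
    injection E1 as E1 E1'. injection E2 as E2 E2'.
    replace (x1 * a - 0 * c + (y1 * b - 0 * d)) with (l1 * x1 - l2 * x2) by (rewrite <- E1; ring).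
    replace (x2 * a - 0 * c + (y2 * b - 0 * d)) with (l1 * x2 + l2 * x1) by (rewrite <- E1'; ring).
    replace (x1 * c + 0 * a + (y1 * d + 0 * b)) with (l1 * y1 - l2 * y2) by (rewrite <- E2; ring).
    replace (x2 * c + 0 * a + (y2 * d + 0 * b)) with (l1 * y2 + l2 * y1) by (rewrite <- E2'; ring).
    ring.
Qed.

Lemma eigenvalue_lt_1 (L : C -> C) (lam : C) :
  real_linear L -> (forall h : C, h <> 0%C -> Cmod (L h) < Cmod h) ->
  eigenvalue L lam -> Cmod lam < 1.
Proof.
  intros HL Hc He. destruct (eigenvalue_energy L lam HL He) as (h & k & Hhk & E).
  assert (Hsq : forall h : C, Cmod (L h) ^ 2 <= Cmod h ^ 2 /\
                  (h <> 0%C -> Cmod (L h) ^ 2 < Cmod h ^ 2)).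
  { intros u. pose proof (Cmod_ge_0 (L u)).
    assert (Hlt : u <> 0%C -> Cmod (L u) ^ 2 < Cmod u ^ 2).
    { intros Hu. specialize (Hc u Hu).
      simpl. rewrite !Rmult_1_r. apply Rmult_le_0_lt_compat; auto. }
    split; [| exact Hlt].
    destruct (Ceq_dec u 0) as [-> | Hu]; [| now apply Rlt_le, Hlt].
    replace (L 0) with (RtoC 0).
    - apply Rle_refl.
    - destruct HL as [_ Hs]. specialize (Hs 0 0%C). rewrite !Cmult_0_l in Hs. easy. }
  destruct (Hsq h) as [H1 H1'], (Hsq k) as [H2 H2'].
  assert (Hlt : Cmod (L h) ^ 2 + Cmod (L k) ^ 2 < Cmod h ^ 2 + Cmod k ^ 2)
    by (destruct Hhk as [Hh | Hk]; [specialize (H1' Hh) | specialize (H2' Hk)]; lra).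
  rewrite E in Hlt. pose proof (pow2_ge_0 (Cmod h)). pose proof (pow2_ge_0 (Cmod k)).
  apply Rnot_le_lt. intros Hl. apply (Rlt_not_le _ _ Hlt).
  rewrite <- (Rmult_1_l (Cmod h ^ 2 + Cmod k ^ 2)) at 1.
  apply Rmult_le_compat_r; [lra |]. rewrite <- (pow1 2). apply pow_incr. lra.
Qed.

Lemma eigenvalue_gt_1 (L : C -> C) (lam : C) :
  real_linear L -> (forall h : C, h <> 0%C -> Cmod h < Cmod (L h)) ->
  eigenvalue L lam -> 1 < Cmod lam.
Proof.
  intros HL Hc He. destruct (eigenvalue_energy L lam HL He) as (h & k & Hhk & E).
  assert (Hlt : forall u : C, u <> 0%C -> Cmod u ^ 2 < Cmod (L u) ^ 2).
  { intros u Hu. specialize (Hc u Hu). pose proof (Cmod_ge_0 u).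
    simpl. rewrite !Rmult_1_r. apply Rmult_le_0_lt_compat; auto. }
  assert (Hle : forall u : C, Cmod u ^ 2 <= Cmod (L u) ^ 2).
  { intros u. destruct (Ceq_dec u 0) as [-> | Hu]; [| now apply Rlt_le, Hlt].
    rewrite Cmod_0. simpl. rewrite Rmult_0_l. apply (pow2_ge_0 (Cmod (L 0))). }
  assert (Hs : Cmod h ^ 2 + Cmod k ^ 2 < Cmod (L h) ^ 2 + Cmod (L k) ^ 2).
  { pose proof (Hle h). pose proof (Hle k).
    destruct Hhk as [Hh | Hk]; [specialize (Hlt h Hh) | specialize (Hlt k Hk)]; lra. }
  rewrite E in Hs. pose proof (pow2_ge_0 (Cmod h)). pose proof (pow2_ge_0 (Cmod k)).
  apply Rnot_le_lt. intros Hl. apply (Rlt_not_le _ _ Hs).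
  rewrite <- (Rmult_1_l (Cmod h ^ 2 + Cmod k ^ 2)) at 2.
  apply Rmult_le_compat_r; [lra |]. rewrite <- (pow1 2). apply pow_incr.
  split; [apply Cmod_ge_0 | exact Hl].
Qed.

(** Multiplication by [1 + mu * a] multiplies every modulus by the same factor
    [q], with [q ^ 2 = 1 + 2 * mu * Re a + mu ^ 2 * Cmod a ^ 2]. A perturbation
    of size at most half of [Rabs (mu * Re a)] cannot compensate the first order term,
    so all directions are contracted, or all are expanded. *)
Lemma near_conformal_modulus (L : C -> C) (a : C) (mu : R) :
  Rabs mu * Cmod a ^ 2 < Rabs (Re a) ->
  (forall h : C, Cmod (L h - h - mu * a * h) <= Rabs mu * (Rabs (Re a) / 2) * Cmod h) ->
  (Re a * mu < 0 -> forall h : C, h <> 0%C -> Cmod (L h) < Cmod h) /\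
  (0 < Re a * mu -> forall h : C, h <> 0%C -> Cmod h < Cmod (L h)).
Proof.
  intros Hsmall HL. set (q := Cmod (1 + mu * a)).
  assert (Hq : q ^ 2 = 1 + 2 * (Re a * mu) + mu ^ 2 * Cmod a ^ 2).
  { unfold q. rewrite !Cmod_sqr. destruct a; simpl. ring. }
  assert (Hq0 : 0 <= q) by apply Cmod_ge_0.
  assert (Hs : Rabs mu * Rabs (Re a) = Rabs (Re a * mu)) by (rewrite Rabs_mult; ring).
  set (s := Rabs (Re a * mu)) in *.
  assert (Hs0 : 0 <= s) by apply Rabs_pos.
  assert (Hra : Rabs (Re a) <= Cmod a) by apply re_le_Cmod.
  pose proof (Rabs_pos mu) as Hmu0. pose proof (Rabs_pos (Re a)) as Hre0.
  assert (Hsm : mu ^ 2 * Cmod a ^ 2 <= s).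
  { rewrite <- (pow2_abs mu), <- Hs. simpl. rewrite !Rmult_1_r, Rmult_assoc.
    apply Rmult_le_compat_l; [lra |]. simpl in Hsmall. rewrite Rmult_1_r in Hsmall. lra. }
  assert (Hs1 : s < 1).
  { rewrite <- Hs. assert (Ha : 0 < Cmod a).
    { assert (0 <= Rabs mu * Cmod a ^ 2) by (apply Rmult_le_pos; [lra | apply pow2_ge_0]). lra. }
    assert (Rabs mu * Cmod a < 1).
    { apply Rmult_lt_reg_r with (Cmod a); [exact Ha |]. simpl in Hsmall. lra. }
    apply Rle_lt_trans with (Rabs mu * Cmod a); [now apply Rmult_le_compat_l | lra]. }
  assert (Hbd : forall h : C, Cmod (L h - h - mu * a * h) <= s / 2 * Cmod h).
  { intros h. replace (s / 2) with (Rabs mu * (Rabs (Re a) / 2)) by (rewrite <- Hs; field).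
    apply HL. }
  assert (Hmul : forall h : C, Cmod (h + mu * a * h) = q * Cmod h).
  { intros h. unfold q. rewrite <- Cmod_mult. f_equal. ring. }
  split; intros Hsign h Hh; apply Cmod_gt_0 in Hh; specialize (Hbd h); specialize (Hmul h).
  - assert (Es : s = - (Re a * mu)) by (apply Rabs_left; lra).
    assert (q < 1 - s / 2).
    { apply Rsqr_incrst_0; [| exact Hq0 | lra]. rewrite !Rsqr_pow2, Hq.
      replace ((1 - s / 2) ^ 2) with (1 - s + s ^ 2 / 4) by field.
      assert (0 < s ^ 2) by (apply pow_lt; lra). lra. }
    replace (L h) with ((L h - h - mu * a * h) + (h + mu * a * h))%C by ring.
    eapply Rle_lt_trans; [apply Cmod_triangle |]. rewrite Hmul.
    assert (q * Cmod h < (1 - s / 2) * Cmod h) by now apply Rmult_lt_compat_r.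
    lra.
  - assert (Es : s = Re a * mu) by (apply Rabs_pos_eq; lra).
    assert (1 + s / 2 < q).
    { apply Rsqr_incrst_0; [| lra | exact Hq0]. rewrite !Rsqr_pow2, Hq.
      replace ((1 + s / 2) ^ 2) with (1 + s + s * s / 4) by field.
      assert (s * s < 1 * s) by (apply Rmult_lt_compat_r; lra).
      assert (0 <= mu ^ 2 * Cmod a ^ 2) by (apply Rmult_le_pos; apply pow2_ge_0). lra. }
    assert (Htri : Cmod (h + mu * a * h) <= Cmod (L h) + Cmod (L h - h - mu * a * h)).
    { rewrite <- (Cmod_opp (L h - h - mu * a * h)).
      replace (h + mu * a * h)%C with (L h + - (L h - h - mu * a * h))%C at 1 by ring.
      apply Cmod_triangle. }
    assert ((1 + s / 2) * Cmod h < q * Cmod h) by now apply Rmult_lt_compat_r.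
    lra.
Qed.

(** * Consequences of the spatio-temporal symmetry *)

Section SpatioTemporalSymmetry.
Context (j : nat) (hj : (1 < j)%nat).
Let T := 2 * PI / INR j.

Lemma period_pos : 0 < T.
Proof.
  unfold T. pose proof PI_RGT_0. apply Rdiv_lt_0_compat; [lra |].
  apply lt_0_INR. lia.
Qed.

Lemma j_periods : INR j * T = 2 * PI.
Proof. unfold T. field. apply not_0_INR. lia. Qed.

Lemma cis_2PI : cis (2 * PI) = 1%C.
Proof. unfold cis. now rewrite cos_2PI, sin_2PI. Qed.

Lemma root_of_unity_neq_1 : cis T <> 1%C.
Proof.
  intros H. assert (Hc : cos T = cos 0) by (rewrite cos_0; now injection H).
  pose proof PI_RGT_0. pose proof period_pos.
  assert (HTPI : T <= PI).
  { assert (INR 2 <= INR j) by (apply le_INR; lia). simpl in H2.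
    pose proof j_periods as Hj.
    assert ((1 + 1) * T <= INR j * T) by (apply Rmult_le_compat_r; lra). lra. }
  assert (cos T < cos 0) by (apply cos_decreasing_1; lra). lra.
Qed.

Lemma rotation_iterate (p : R -> C) :
  (forall t, p (t + T) = (cis T * p t)%C) ->
  forall (n : nat) t, p (t + INR n * T) = (cis (INR n * T) * p t)%C.
Proof.
  intros Hp. induction n as [| n IH]; intros t.
  - simpl. rewrite Rmult_0_l, Rplus_0_r, cis_0. ring.
  - rewrite S_INR. replace (t + (INR n + 1) * T) with (t + INR n * T + T) by ring.
    replace ((INR n + 1) * T) with (T + INR n * T) by ring.
    rewrite Hp, IH, cis_plus. ring.
Qed.

Lemma rotation_periodic (p : R -> C) :
  (forall t, p (t + T) = (cis T * p t)%C) -> forall t, p (t + 2 * PI) = p t.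
Proof.
  intros Hp t. rewrite <- j_periods, (rotation_iterate p Hp), j_periods, cis_2PI. ring.
Qed.

(** Rotating the time average by the symmetry does not change it. *)
Lemma rotating_wave_centered (p : R -> C) :
  (forall t, continuous_C p t) -> (forall t, p (t + T) = (cis T * p t)%C) ->
  center p = RtoC 0.
Proof.
  intros Hc Hp. pose proof (rotation_periodic p Hp) as Hper.
  destruct (is_RInt_C_continuous p 0 (2 * PI) Hc) as [I HI].
  destruct (is_RInt_C_continuous p 0 T Hc) as [J HJ].
  assert (H1 : is_RInt_C p T (2 * PI + T) I).
  { replace I with (plus (opp J) (plus I J) : C_R_NormedModule).
    - apply (is_RInt_Chasles (V := C_R_NormedModule) p T 0).
      + now apply (is_RInt_swap (V := C_R_NormedModule)).
      + apply (is_RInt_Chasles (V := C_R_NormedModule) p 0 (2 * PI)); [exact HI |].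
        assert (H : is_RInt_C (fun s => p (s + - (2 * PI))) (2 * PI) (2 * PI + T) J).
        { apply is_RInt_C_shift. replace (2 * PI + - (2 * PI)) with 0 by ring.
          now replace (2 * PI + T + - (2 * PI)) with T by ring. }
        revert H. apply is_RInt_C_eq; [| reflexivity].
        intros s. rewrite <- Hper. f_equal. ring.
    - change (- J + (I + J) = I)%C. ring. }
  assert (H2 : is_RInt_C (fun s => p (s + T)) 0 (2 * PI) I).
  { apply is_RInt_C_shift. now rewrite Rplus_0_l. }
  assert (H3 : is_RInt_C (fun s => p (s + T)) 0 (2 * PI) (cis T * I)%C).
  { apply (is_RInt_C_eq (fun s => cis T * p s)%C _ _ _ (cis T * I)%C); [| reflexivity |].
    - intros s. now rewrite Hp.
    - now apply is_RInt_C_mult. }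
  pose proof (is_RInt_C_uniq _ _ _ _ _ H2 H3) as E.
  assert (HI0 : I = 0%C).
  { destruct (Ceq_dec I 0) as [| Hn]; [assumption |]. exfalso.
    apply root_of_unity_neq_1. apply (f_equal (fun z => z / I)%C) in E.
    replace (cis T) with (cis T * I / I)%C by (field; exact Hn).
    rewrite <- E. field. exact Hn. }
  unfold center. rewrite (is_RInt_unique (V := C_R_CompleteNormedModule) _ _ _ _ HI), HI0. ring.
Qed.
End SpatioTemporalSymmetry.

Lemma is_RInt_C_cis_double : is_RInt_C (fun s => cis (2 * s)) 0 (2 * PI) (RtoC 0).
Proof.
  eapply is_RInt_C_eq; [reflexivity | |
    apply (is_RInt_C_of_derive (fun s => (sin (2 * s) / 2, - cos (2 * s) / 2)))].
  - replace (2 * (2 * PI)) with (0 + 2 * INR 2 * PI) by (simpl; ring).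
    rewrite sin_period, cos_period, Rmult_0_r.
    unfold Cminus, Cplus, Copp, RtoC; simpl. f_equal; ring.
  - intros t. apply is_derive_C_intro; unfold cis; simpl; auto_derive; auto; field.
  - intros t. apply (continuous_comp (fun s => 2 * s) cis).
    + apply continuity_pt_filterlim. reg.
    + apply continuous_C_cis.
Qed.

Lemma filterdiff_translate (f L : C -> C) (a w : C) :
  @filterdiff R_AbsRing C_R_NormedModule C_R_NormedModule f
    (locally (T := C_R_NormedModule) a) L ->
  @filterdiff R_AbsRing C_R_NormedModule C_R_NormedModule (fun z => w + f (z - w))%C
    (locally (T := C_R_NormedModule) (w + a)%C) L.
Proof.
  intros H.
  assert (Hs : @filterdiff R_AbsRing C_R_NormedModule C_R_NormedModule (fun z => z - w)%C
    (locally (T := C_R_NormedModule) (w + a)%C) (fun z => z)).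
  { apply (filterdiff_ext_lin (U := C_R_NormedModule) (V := C_R_NormedModule)
           _ (fun z => minus z zero)).
    - apply (filterdiff_minus_fct (fun z : C_R_NormedModule => z) (fun _ => w)).
      + apply filterdiff_id.
      + apply (filterdiff_const (U := C_R_NormedModule) (V := C_R_NormedModule)).
    - intros z. apply minus_zero_r. }
  apply (filterdiff_ext_lin (U := C_R_NormedModule) (V := C_R_NormedModule)
           _ (fun z => plus zero (L z))).
  - apply (filterdiff_plus_fct (U := C_R_NormedModule) (V := C_R_NormedModule)
             (fun _ : C_R_NormedModule => w) (fun z => f (z - w)%C)).
    + apply (filterdiff_const (U := C_R_NormedModule) (V := C_R_NormedModule)).
    + apply (filterdiff_comp' (U := C_R_NormedModule) (V := C_R_NormedModule)
             (W := C_R_NormedModule) (fun z => z - w)%C f (w + a)%C (fun z => z) L Hs).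
      now replace (w + a - w)%C with a by ring.
  - intros z. apply (plus_zero_l (G := C_R_NormedModule)).
Qed.

(** * Deviation from the unperturbed circle *)

Section CoMovingFrame.
(** [g] stands for [eps * G t eps] and [h] for [H1 w mu], at fixed values of the
    parameters. For [g = 0] and [mu = 0] the symmetric solution is
    [w0 * cis t] with [w0 = - i v]; the deviation from it obeys an equation
    whose right-hand side and Lipschitz constant are of the order of the
    parameters. *)
Context (v : C) (g : R -> C) (h : C -> C) (mu T r rho k : R).
Let w0 := (- (Ci * v))%C.

Definition bundle_field (t : R) (p : C) : C := (cis t * (v + g t + mu * h (p * cis (- t))))%C.
Definition deviation_field (t : R) (y : C) : C := (cis t * (g t + mu * h (w0 + y * cis (- t))))%C.
Definition reference_circle (t : R) : C := (w0 * cis t)%C.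

Lemma field_decomposition (t : R) (y : C) :
  bundle_field t (reference_circle t + y)%C = (v * cis t + deviation_field t y)%C.
Proof.
  unfold bundle_field, deviation_field, reference_circle.
  replace ((w0 * cis t + y) * cis (- t))%C with (w0 * (cis t * cis (- t)) + y * cis (- t))%C by ring.
  rewrite cis_opp_r, Cmult_1_r. ring.
Qed.

Lemma is_derive_reference_circle (t : R) : is_derive_C reference_circle t (v * cis t)%C.
Proof.
  pose proof (is_derive_C_cis w0 t) as H.
  replace (w0 * (Ci * cis t))%C with (v * cis t)%C in H; [exact H |].
  unfold w0. destruct v, (cis t). unfold Cmult, Copp, Ci; simpl. f_equal; ring.
Qed.

Lemma solution_iff_deviation (I : R -> Prop) (y : R -> C) :
  (forall t, I t -> is_derive_C y t (deviation_field t (y t))) <->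
  solution_on I bundle_field (fun t => reference_circle t + y t)%C.
Proof.
  split; intros H t Ht; specialize (H t Ht).
  - rewrite field_decomposition.
    apply (is_derive_plus (V := C_R_NormedModule) reference_circle y); auto.
    apply is_derive_reference_circle.
  - cbv beta in H. rewrite field_decomposition in H.
    pose proof (is_derive_minus (V := C_R_NormedModule) _ _ _ _ _ H
                  (is_derive_reference_circle t)) as H'.
    replace (deviation_field t (y t)) with
      (minus (v * cis t + deviation_field t (y t))%C (v * cis t)%C : C_R_NormedModule)
      by (change (v * cis t + deviation_field t (y t) - v * cis t = deviation_field t (y t))%C; ring).
    revert H'. apply (is_derive_ext (V := C_R_NormedModule)).
    intros s. change (reference_circle s + y s - reference_circle s = y s)%C. ring.
Qed.

Context (g_continuous : forall t, continuous_C g t)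
  (h_continuous : forall (w : R -> C) t, continuous_C w t -> continuous_C (fun s => h (w s)) t)
  (field_small : forall t w, Cmod (g t + mu * h w) <= rho)
  (h_lipschitz : forall w w', Cmod (w - w0) <= r -> Cmod (w' - w0) <= r ->
     Cmod (h w' - h w) <= k * Cmod (w' - w))
  (Hr : 0 < r) (Hk : 0 <= k) (Hrho : 0 <= rho).

Lemma deviation_field_bounded t y : Cmod (deviation_field t y) <= rho.
Proof. unfold deviation_field. now rewrite Cmod_cis_mult. Qed.

Lemma continuous_C_cis_opp t : continuous_C (fun s => cis (- s)) t.
Proof.
  apply (continuous_comp (fun s : R => - s) cis); [| apply continuous_C_cis].
  apply (continuous_opp (fun s : R => s)), continuous_id.
Qed.

Lemma continuous_co_moving (y : R -> C) t :
  (forall t, continuous_C y t) -> continuous_C (fun s => w0 + y s * cis (- s))%C t.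
Proof.
  intros Hy. apply continuous_C_plus; [apply continuous_const |].
  apply continuous_C_mult; [apply Hy | apply continuous_C_cis_opp].
Qed.

Lemma deviation_field_continuous (y : R -> C) :
  (forall t, continuous_C y t) -> forall t, continuous_C (fun s => deviation_field s (y s)) t.
Proof.
  intros Hy t. apply continuous_C_mult; [apply continuous_C_cis |].
  apply continuous_C_plus; [apply g_continuous |].
  apply continuous_C_mult; [apply continuous_const |].
  apply (h_continuous (fun s => w0 + y s * cis (- s))%C). now apply continuous_co_moving.
Qed.

Lemma co_moving_in_ball t y : Cmod y <= r -> Cmod (w0 + y * cis (- t) - w0) <= r.
Proof.
  intros H. replace (w0 + y * cis (- t) - w0)%C with (y * cis (- t))%C by ring.
  now rewrite Cmod_mult_cis.
Qed.

Lemma deviation_field_lipschitz t x y : Cmod x <= r -> Cmod y <= r ->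
  Cmod (deviation_field t x - deviation_field t y) <= Rabs mu * k * Cmod (x - y).
Proof.
  intros Hx Hy. unfold deviation_field.
  replace (cis t * (g t + mu * h (w0 + x * cis (- t))) -
           cis t * (g t + mu * h (w0 + y * cis (- t))))%C
    with (cis t * (mu * (h (w0 + x * cis (- t)) - h (w0 + y * cis (- t)))))%C by ring.
  rewrite Cmod_cis_mult, Cmod_mult, Cmod_R, Rmult_assoc.
  apply Rmult_le_compat_l; [apply Rabs_pos |].
  rewrite <- (Cmod_mult_cis (- t) (x - y)).
  replace ((x - y) * cis (- t))%C with (w0 + x * cis (- t) - (w0 + y * cis (- t)))%C by ring.
  apply h_lipschitz; now apply co_moving_in_ball.
Qed.

Lemma deviation_field_equivariant :
  (forall t, g (t + T) = g t) -> forall t y,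
  deviation_field (t + T) (cis T * y)%C = (cis T * deviation_field t y)%C.
Proof.
  intros Hg t y. unfold deviation_field. rewrite Hg, cis_plus.
  replace (cis T * y * cis (- (t + T)))%C with (y * cis (- t))%C.
  - ring.
  - rewrite Ropp_plus_distr, cis_plus.
    replace (cis T * y * (cis (- t) * cis (- T)))%C
      with (y * cis (- t) * (cis T * cis (- T)))%C by ring.
    rewrite cis_opp_r. ring.
Qed.

Context (D : C -> C -> C) (alpha beta : C) (eta : R) (y0 : R -> C)
  (D_linear : forall w, real_linear (D w))
  (D_continuous : forall (w u : R -> C) t, continuous_C w t -> continuous_C u t ->
     continuous_C (fun s => D (w s) (u s)) t)
  (D_taylor : forall w w', Cmod (w - w0) <= r -> Cmod (w' - w0) <= r ->
     Cmod (h w' - h w - D w (w' - w)%C) <= k * Cmod (w' - w) ^ 2)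
  (D_near : forall w u, Cmod (w - w0) <= r ->
     Cmod (D w u - (alpha * u + beta * Cconj u)) <= eta * Cmod u)
  (D_bounded : forall w u, Cmod (w - w0) <= r -> Cmod (D w u) <= k * Cmod u)
  (small_rho : 9 * rho <= r / 4) (small_mu : 9 * (Rabs mu * k) <= 1 / 2)
  (y0_solution : forall t, is_derive_C y0 t (deviation_field t (y0 t)))
  (y0_small : forall t, Cmod (y0 t) <= r / 2).

Definition linearized_field (t : R) (u : C) : C :=
  (mu * (cis t * D (w0 + y0 t * cis (- t)) (u * cis (- t))))%C.

Lemma y0_in_ball t : Cmod (w0 + y0 t * cis (- t) - w0) <= r.
Proof. apply co_moving_in_ball. pose proof (y0_small t). lra. Qed.

Lemma y0_continuous t : continuous_C y0 t.
Proof. eapply is_derive_C_continuous, y0_solution. Qed.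

Lemma linearized_field_linear t : real_linear (linearized_field t).
Proof.
  destruct (D_linear (w0 + y0 t * cis (- t))%C) as [Hp Hs].
  split; intros; unfold linearized_field.
  - rewrite Cmult_plus_distr_r, Hp. ring.
  - rewrite <- Cmult_assoc, Hs. ring.
Qed.

Lemma linearized_field_bounded t u : Cmod (linearized_field t u) <= Rabs mu * k * Cmod u.
Proof.
  unfold linearized_field.
  rewrite Cmod_mult, Cmod_R, Cmod_cis_mult, Rmult_assoc.
  apply Rmult_le_compat_l; [apply Rabs_pos |].
  rewrite <- (Cmod_mult_cis (- t) u). apply D_bounded, y0_in_ball.
Qed.

Lemma linearized_field_continuous (u : R -> C) :
  (forall t, continuous_C u t) -> forall t, continuous_C (fun s => linearized_field s (u s)) t.
Proof.
  intros Hu t. apply continuous_C_mult; [apply continuous_const |].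
  apply continuous_C_mult; [apply continuous_C_cis |].
  apply (D_continuous (fun s => w0 + y0 s * cis (- s))%C (fun s => u s * cis (- s))%C).
  - apply continuous_co_moving, y0_continuous.
  - apply continuous_C_mult; [apply Hu | apply continuous_C_cis_opp].
Qed.

Lemma linearized_field_taylor t x : Cmod x <= r ->
  Cmod (deviation_field t x - deviation_field t (y0 t) - linearized_field t (x - y0 t)%C)
  <= Rabs mu * k * Cmod (x - y0 t) ^ 2.
Proof.
  intros Hx. unfold deviation_field, linearized_field.
  set (w := (w0 + y0 t * cis (- t))%C). set (w' := (w0 + x * cis (- t))%C).
  assert (E : ((x - y0 t) * cis (- t) = w' - w)%C) by (unfold w, w'; ring).
  rewrite E.
  replace (cis t * (g t + mu * h w') - cis t * (g t + mu * h w)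
           - mu * (cis t * D w (w' - w)%C))%C
    with (mu * (cis t * (h w' - h w - D w (w' - w)%C)))%C by ring.
  rewrite Cmod_mult, Cmod_R, Cmod_cis_mult, Rmult_assoc.
  apply Rmult_le_compat_l; [apply Rabs_pos |].
  rewrite <- (Cmod_mult_cis (- t) (x - y0 t)), E.
  apply D_taylor; [apply y0_in_ball | now apply co_moving_in_ball].
Qed.

(** The rotation of the frame leaves the complex-linear part [alpha] constant
    but makes the conjugate-linear part turn with angular velocity [2], so that
    it averages out over a period. *)
Lemma linearized_field_near t u :
  Cmod (linearized_field t u - mu * (alpha * u + beta * Cconj u * cis (2 * t)))
  <= Rabs mu * eta * Cmod u.
Proof.
  unfold linearized_field.
  set (w := (w0 + y0 t * cis (- t))%C).
  assert (E : (alpha * u + beta * Cconj u * cis (2 * t) =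
     cis t * (alpha * (u * cis (- t)) + beta * Cconj (u * cis (- t))))%C).
  { assert (Ec : Cconj (cis (- t)) = cis t).
    { unfold Cconj, cis; simpl. now rewrite cos_neg, sin_neg, Ropp_involutive. }
    rewrite Cmult_conj, Ec. replace (2 * t) with (t + t) by ring. rewrite cis_plus.
    replace (cis t * (alpha * (u * cis (- t)) + beta * (Cconj u * cis t)))%C
      with (alpha * u * (cis t * cis (- t)) + beta * Cconj u * (cis t * cis t))%C by ring.
    rewrite cis_opp_r. ring. }
  rewrite E.
  replace (mu * (cis t * D w (u * cis (- t))%C) -
     mu * (cis t * (alpha * (u * cis (- t)) + beta * Cconj (u * cis (- t)))))%C
   with (mu * (cis t * (D w (u * cis (- t))%C -
     (alpha * (u * cis (- t)) + beta * Cconj (u * cis (- t))))))%C by ring.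
  rewrite Cmod_mult, Cmod_R, Cmod_cis_mult, Rmult_assoc.
  apply Rmult_le_compat_l; [apply Rabs_pos |].
  rewrite <- (Cmod_mult_cis (- t) u). apply D_near, y0_in_ball.
Qed.

(** Solutions are constructed on [[-9, 9]], an interval that contains
    [[0, 2 * PI]] in its interior. *)
Lemma two_PI_lt_9 : 0 < 2 * PI < 9.
Proof. pose proof PI_RGT_0. pose proof PI_4. lra. Qed.

(** To first order in [mu], the monodromy is the time average of the linearized
    field applied to a constant vector: multiplication by [2 * PI * alpha]. The
    error has two sources, the oscillation [eta] of the derivative near
    [w0] and the displacement of solutions of the variational equation during
    one period, which is itself of order [mu]. *)
Lemma monodromy_expansion :
  exists L : C -> C,
    is_monodromy bundle_field (fun t => reference_circle t + y0 t)%C L /\ real_linear L /\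
    forall u, Cmod (L u - u - mu * (2 * PI * alpha)%C * u)
      <= 9 * (Rabs mu * eta + 18 * (Rabs mu * k) ^ 2) * Cmod u.
Proof.
  pose proof two_PI_lt_9 as HPI.
  assert (Hmk : 0 <= Rabs mu * k) by (apply Rmult_le_pos; [apply Rabs_pos | auto]).
  destruct (flow_differentiable (V := C_R_CompleteNormedModule) deviation_field linearized_field
    y0 9 rho (Rabs mu * k) (Rabs mu * k) r) as (X & U & HX & HU & Hd); auto; try lra.
  - intros x Hx _ s. now apply deviation_field_continuous.
  - intros s x _. rewrite norm_C. apply deviation_field_bounded.
  - intros s x y. rewrite !norm_C. apply deviation_field_lipschitz.
  - intros t. rewrite norm_C. apply y0_small.
  - intros t _. apply (is_RInt_C_of_derive y0 (fun s => deviation_field s (y0 s))); auto.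
    apply deviation_field_continuous, y0_continuous.
  - intros s x y. apply linearized_field_linear.
  - intros s a x. rewrite !scal_C. apply linearized_field_linear.
  - intros s x. rewrite !norm_C. apply linearized_field_bounded.
  - intros x Hx s. now apply linearized_field_continuous.
  - intros s x. rewrite !norm_C. apply linearized_field_taylor.
  - assert (H2PI : Rabs (2 * PI) <= 9) by (rewrite Rabs_pos_eq; lra).
    specialize (Hd (2 * PI) H2PI).
    assert (Hc0 : reference_circle 0 = w0) by (unfold reference_circle; rewrite cis_0; ring).
    assert (Hc1 : reference_circle (2 * PI) = w0)
      by (unfold reference_circle; rewrite cis_2PI; ring).
    exists (fun u => U u (2 * PI)). split; [| split].
    + exists (fun z => w0 + X (z - w0)%C (2 * PI)%R)%C. rewrite Hc0. split.
      * assert (Hq : 0 < r / 4) by lra.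
        assert (Hloc : locally (T := C_R_NormedModule) (w0 + y0 0)%C
                         (fun z => Cmod (z - (w0 + y0 0%R)) < r / 4)).
        { apply (locally_le_locally_norm (V := C_R_NormedModule)).
          exists (mkposreal _ Hq). intros z Hz. red in Hz. now rewrite norm_C in Hz. }
        unfold time_2PI_map_near. revert Hloc. apply filter_imp. intros z Hz.
        assert (Hzr : Cmod (z - w0) <= 3 / 4 * r).
        { replace (z - w0)%C with ((z - (w0 + y0 0%R)) + y0 0%R)%C by ring.
          eapply Rle_trans; [apply Cmod_triangle |]. pose proof (y0_small 0). lra. }
        destruct (HX (z - w0)%C) as (Hxc & _ & Hxi); [now rewrite norm_C |].
        exists (fun t => reference_circle t + X (z - w0)%C t)%C. split; [| split].
        -- apply solution_iff_deviation. intros t Ht.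
           apply (is_derive_C_of_RInt (X (z - w0)%C)
             (fun s => deviation_field s (X (z - w0)%C s)) (z - w0)%C 9).
           ++ exact Hxi.
           ++ now apply deviation_field_continuous.
           ++ rewrite Rabs_pos_eq; lra.
        -- rewrite Hc0. specialize (Hxi 0). rewrite Rabs_R0 in Hxi.
           specialize (Hxi ltac:(lra)).
           pose proof (is_RInt_C_uniq _ _ _ _ _ Hxi
             (is_RInt_point (V := C_R_NormedModule) _ 0)) as E.
           apply (minus_zero_eq (V := C_R_NormedModule)) in E. rewrite E. ring.
        -- now rewrite Hc1.
      * apply (filterdiff_translate (fun z => X z (2 * PI))). exact Hd.
    + destruct Hd as [Hlin _]. split.
      * intros u u'. apply (linear_plus _ Hlin).
      * intros a u. rewrite <- !scal_C. apply (linear_scal _ Hlin).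
    + intros u. destruct (HU u) as (Huc & Hub & Hui).
      set (e := fun s => (linearized_field s (U u s)
                  - mu * (alpha * u + beta * Cconj u * cis (2 * s)))%C).
      assert (He : is_RInt_C e 0 (2 * PI) (U u (2 * PI)%R - u - mu * (2 * PI * alpha)%C * u)%C).
      { apply (is_RInt_minus (V := C_R_NormedModule)).
        - now apply Hui.
        - eapply is_RInt_C_eq; [reflexivity | | apply is_RInt_C_mult,
            (is_RInt_plus (V := C_R_NormedModule)), is_RInt_C_mult, is_RInt_C_cis_double;
            apply (is_RInt_const (V := C_R_NormedModule))].
          change (mu * (@scal R_AbsRing C_R_NormedModule (2 * PI - 0)%R (alpha * u)
            + beta * Cconj u * 0) = mu * (2 * PI * alpha) * u)%C.
          rewrite scal_C, Rminus_0_r, RtoC_mult. ring. }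
      assert (Hstay : forall s, Rabs s <= 9 ->
                Cmod (U u s - u) <= 9 * (Rabs mu * k * (2 * Cmod u))).
      { intros s Hs. rewrite <- norm_C.
        refine (is_RInt_norm_le (V := C_R_NormedModule) _ _ _ _ _ _ _ _ _ (Hui s Hs)).
        - now rewrite Rminus_0_r.
        - apply Rmult_le_pos; [auto | pose proof (Cmod_ge_0 u); lra].
        - intros q _. rewrite norm_C. eapply Rle_trans; [apply linearized_field_bounded |].
          apply Rmult_le_compat_l; [auto |]. rewrite <- !norm_C. apply Hub. }
      rewrite Rmult_assoc, <- norm_C.
      refine (is_RInt_norm_le (V := C_R_NormedModule) _ _ _ _ _ _ _ _ _ He).
      * rewrite Rminus_0_r. exact H2PI.
      * assert (Heta : 0 <= Rabs mu * eta * Cmod u).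
        { eapply Rle_trans; [apply Cmod_ge_0 | apply (linearized_field_near 0 u)]. }
        rewrite Rmult_plus_distr_r. apply Rplus_le_le_0_compat; [exact Heta |].
        apply Rmult_le_pos; [| apply Cmod_ge_0].
        apply Rmult_le_pos; [lra | apply pow2_ge_0].
      * intros s Hs. rewrite Rmin_left, Rmax_right in Hs by lra.
        rewrite norm_C. unfold e.
        replace (linearized_field s (U u s) - mu * (alpha * u + beta * Cconj u * cis (2 * s)))%C
          with ((linearized_field s u - mu * (alpha * u + beta * Cconj u * cis (2 * s)))
            + linearized_field s (U u s - u)%C)%C.
        2:{ replace (linearized_field s (U u s)) with
              (linearized_field s (u + (U u s - u))%C) by (f_equal; ring).
            rewrite (proj1 (linearized_field_linear s)). ring. }
        eapply Rle_trans; [apply Cmod_triangle |]. rewrite Rmult_plus_distr_r.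
        apply Rplus_le_compat; [apply linearized_field_near |].
        eapply Rle_trans; [apply linearized_field_bounded |].
        apply Rle_trans with (Rabs mu * k * (9 * (Rabs mu * k * (2 * Cmod u)))).
        -- apply Rmult_le_compat_l; [auto |]. apply Hstay. rewrite Rabs_pos_eq; lra.
        -- right. ring.
Qed.
End CoMovingFrame.

(** * Choice of the neighbourhood and conclusion *)

Lemma linear_constraints_near_0 (l : list (R * R)) :
  List.Forall (fun cb => 0 < snd cb) l ->
  exists d, 0 < d /\ forall x, 0 <= x < d -> List.Forall (fun cb => fst cb * x < snd cb) l.
Proof.
  induction 1 as [| [c b] l Hb _ (d & Hd & IH)].
  - exists 1. split; [lra | constructor].
  - simpl in Hb. pose proof (Rabs_pos c).
    assert (Hq : 0 < b / (Rabs c + 1)) by (apply Rdiv_lt_0_compat; lra).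
    exists (Rmin d (b / (Rabs c + 1))). split; [now apply Rmin_pos |].
    pose proof (Rmin_l d (b / (Rabs c + 1))). pose proof (Rmin_r d (b / (Rabs c + 1))).
    intros x Hx. constructor; [simpl | apply IH; lra].
    apply Rle_lt_trans with ((Rabs c + 1) * x).
    + apply Rmult_le_compat_r; [lra |]. pose proof (Rle_abs c). lra.
    + replace b with ((Rabs c + 1) * (b / (Rabs c + 1))) by (field; lra).
      apply Rmult_lt_compat_l; lra.
Qed.

Theorem theorem3p4 (j : nat) (hj : (1 < j)%nat) (v : C)
    (G : R -> R -> C) (hG : admissible_G j G)
    (H1 : C -> R -> C) (hH1 : admissible_H1 H1)
    (halpha : Re (alpha1 v H1) <> 0) :
  exists W : R * R -> Prop,
    locally ((0, 0) : R * R) (fun q => q <> (0, 0) -> W q) /\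
    ~ W (0, 0) /\
    forall eps mu : R, W (eps, mu) ->
      let F := center_bundle v G H1 eps mu in
      exists p : R -> C,
        unique (fun q => discrete_rotating_wave j F q /\
                         (mu <> 0 -> hyperbolic F q) /\
                         center q = RtoC 0) p /\
        (Re (alpha1 v H1) * mu < 0 -> anchored_at F p (RtoC 0)).
Proof.
  set (T := 2 * PI / INR j).
  assert (HT : 0 < T) by now apply period_pos.
  assert (Hzeta : cis T <> 1%C) by now apply root_of_unity_neq_1.
  set (zeta := cis T) in *.
  destruct hG as (deltaG & HGs & HGper).
  destruct (periodic_family_bounded G T deltaG HT (fun t eps => HGs 0%nat (t, eps)) HGper)
    as (dG & MG & HdG & HMG & HdG' & HGb).
  destruct hH1 as (deltaH & HHs & MH & HHb).
  pose proof (cond_pos deltaH) as HdH.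
  assert (HMH : 0 <= MH).
  { eapply Rle_trans; [apply Cmod_ge_0 | apply (HHb 0%C 0)]. now rewrite Rabs_R0. }
  set (w0 := (- (Ci * v))%C).
  destruct (local_linearization H1 deltaH w0 HHs)
    as (D & beta & rl & K & Hrl & HK & HDp & HDs & Hloc & Hnear).
  set (alpha := alpha1 v H1) in *.
  change (wirtinger (fun z => H1 z 0) w0) with alpha in Hnear.
  set (ra := Rabs (Re alpha)).
  assert (Hra : 0 < ra) by now apply Rabs_pos_lt.
  pose proof PI_RGT_0 as HPI.
  assert (HPra : 0 < PI * ra) by now apply Rmult_lt_0_compat.
  (* [eta] and the last constraint below each use up half of the allowed error
     [Rabs (Re a) / 2 = PI * ra] in the expansion of the monodromy. *)
  set (eta := PI * ra / 18).
  assert (Heta : 0 < eta) by (unfold eta; lra).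
  destruct (Hnear eta Heta) as (s & Hs & HDn).
  set (r := Rmin rl s).
  assert (Hr : 0 < r) by now apply Rmin_pos.
  assert (Hrr : r <= rl /\ r <= s) by (split; [apply Rmin_l | apply Rmin_r]).
  (* a common bound for the Lipschitz and Taylor constants and for the derivative *)
  set (k := K + (Cmod alpha + Cmod beta + eta)).
  pose proof (Cmod_ge_0 alpha) as Ha0. pose proof (Cmod_ge_0 beta) as Hb0.
  assert (Hk : 0 <= k) by (unfold k; lra).
  set (a := (2 * PI * alpha)%C).
  assert (Ea : Re a = 2 * PI * Re alpha) by (unfold a; destruct alpha; simpl; ring).
  assert (Hra' : Rabs (Re a) = 2 * (PI * ra)).
  { rewrite Ea, Rabs_mult, (Rabs_pos_eq (2 * PI)) by lra. unfold ra. ring. }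
  set (kap := Cmod (/ (zeta - 1))).
  assert (Hkap : 0 <= kap) by apply Cmod_ge_0.
  (* In order: the domains of the data; the deviation stays in the ball of
     radius [r]; the rotating wave lies in the ball of radius [r / 2]; the two
     integral operators are contractions; the spectral conditions. *)
  destruct (linear_constraints_near_0
    ((1, dG) :: (1, (deltaH : R)) :: (1, rl) :: (1, s)
     :: (9 * MG, r / 8) :: (9 * MH, r / 8)
     :: (T * kap * MG, r / 4) :: (T * kap * MH, r / 4)
     :: (T * kap * k, 1 / 2) :: (9 * k, 1 / 2)
     :: (Cmod a ^ 2, 2 * (PI * ra)) :: (9 * (18 * k ^ 2), PI * ra / 2) :: nil)%list)
    as (d & Hd & Hsmall).
  { repeat constructor; simpl; lra. }
  exists (fun q => q <> (0, 0) /\ Rabs (fst q) < d /\ Rabs (snd q) < d).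
  split; [| split].
  - exists (mkposreal d Hd). intros [e m] [He Hm] Hne.
    change (Rabs (e - 0) < d) in He. change (Rabs (m - 0) < d) in Hm.
    rewrite Rminus_0_r in He, Hm. now repeat split.
  - intros [H _]. now apply H.
  - intros eps mu (_ & Heps & Hmu) F. simpl in Heps, Hmu.
    pose proof (Rabs_pos eps) as He0. pose proof (Rabs_pos mu) as Hm0.
    pose proof (Hsmall (Rabs eps) (conj He0 Heps)) as He.
    pose proof (Hsmall (Rabs mu) (conj Hm0 Hmu)) as Hm.
    clear Hsmall. rewrite !List.Forall_cons_iff in He, Hm. simpl fst in He, Hm. simpl snd in He, Hm.
    destruct He as (E1 & _ & _ & _ & E2 & _ & E3 & _).
    destruct Hm as (_ & M1 & M2 & M3 & _ & M4 & _ & M5 & M6 & M7 & M8 & M9 & _).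
    set (g := fun t => (eps * G t eps)%C). set (h := fun w => H1 w mu).
    set (rho := MG * Rabs eps + MH * Rabs mu).
    assert (Hrho : 0 <= rho) by (apply Rplus_le_le_0_compat; now apply Rmult_le_pos).
    destruct (Hloc mu ltac:(lra)) as (Hhc & HDc & HDt).
    assert (Hgc : forall t, continuous_C g t).
    { intros t. apply continuous_C_mult; [apply continuous_const |].
      apply (continuous_comp_2 (fun t : R => t) (fun _ : R => eps) G t);
        [apply continuous_id | apply continuous_const |].
      apply (HGs 0%nat (t, eps)). simpl. lra. }
    assert (Hgper : forall t, g (t + T) = g t).
    { intros t. unfold g. f_equal. apply HGper. lra. }
    assert (Hfield : forall t w, Cmod (g t + mu * h w) <= rho).
    { intros t w. eapply Rle_trans; [apply Cmod_triangle |].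
      unfold g, h, rho. rewrite !Cmod_mult, !Cmod_R, (Rmult_comm MG), (Rmult_comm MH).
      apply Rplus_le_compat; apply Rmult_le_compat_l; auto.
      - apply HGb. lra.
      - apply HHb. lra. }
    assert (HhL : forall w w', Cmod (w - w0) <= r -> Cmod (w' - w0) <= r ->
              Cmod (h w' - h w) <= k * Cmod (w' - w)).
    { intros w w' Hw Hw'. apply Rle_trans with (K * Cmod (w' - w)).
      - apply HDt; lra.
      - apply Rmult_le_compat_r; [apply Cmod_ge_0 | unfold k; lra]. }
    set (Y := deviation_field v g h mu).
    assert (HYc : forall y : R -> C, (forall t, continuous_C y t) ->
              forall t, continuous_C (fun s => Y s (y s)) t)
      by (apply deviation_field_continuous; auto).
    assert (HYL : forall t x y, Cmod x <= r / 2 -> Cmod y <= r / 2 ->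
              Cmod (Y t x - Y t y) <= Rabs mu * k * Cmod (x - y)).
    { intros t x y Hx Hy. apply (deviation_field_lipschitz v g h mu r k HhL); lra. }
    assert (HYb : forall t y, Cmod (Y t y) <= rho)
      by (intros; now apply deviation_field_bounded).
    assert (HYe : forall t y, Y (t + T) (cis T * y)%C = (cis T * Y t y)%C)
      by (now apply deviation_field_equivariant).
    assert (Hmk : 0 <= Rabs mu * k) by now apply Rmult_le_pos.
    assert (S1 : T * (kap * rho) <= r / 2).
    { replace (T * (kap * rho)) with (T * kap * MG * Rabs eps + T * kap * MH * Rabs mu)
        by (unfold rho; ring). lra. }
    assert (S2 : T * (kap * (Rabs mu * k)) <= 1 / 2)
      by (replace (T * (kap * (Rabs mu * k))) with (T * kap * k * Rabs mu) by ring; lra).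
    assert (Hr2 : 0 <= r / 2) by lra.
    assert (HT0 : 0 <= T) by lra.
    destruct (rotating_wave_exists T (r / 2) rho (Rabs mu * k) Y HT0 Hzeta Hmk Hrho Hr2
                HYb HYc HYL HYe S1 S2) as (y & Hy & Hyrot & Hyr).
    set (x0 := reference_circle v).
    assert (Hx0 : forall t, x0 (t + T) = (cis T * x0 t)%C).
    { intros t. unfold x0, reference_circle. rewrite cis_plus. ring. }
    set (p := fun t => (x0 t + y t)%C).
    assert (Hsol : solution_on (fun _ => True) F p).
    { apply (solution_iff_deviation v g h mu (fun _ => True) y). intros t _. apply Hy. }
    assert (Hprot : forall t, p (t + T) = (cis T * p t)%C).
    { intros t. unfold p. rewrite Hx0, Hyrot. fold zeta. ring. }
    assert (Hcenter : center p = RtoC 0).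
    { apply (rotating_wave_centered j hj); [| exact Hprot].
      intros t. eapply is_derive_C_continuous. now apply Hsol. }
    destruct (monodromy_expansion v g h mu r rho k Hgc Hhc Hfield HhL Hr Hk Hrho
      (fun w => D w mu) alpha beta eta y) as (L & HL & HLlin & HLexp); auto.
    { intros w. split; [apply HDp | apply HDs]. }
    { fold w0. intros w w' Hw Hw'. apply Rle_trans with (K * Cmod (w' - w) ^ 2).
      - apply HDt; lra.
      - apply Rmult_le_compat_r; [apply pow2_ge_0 | unfold k; lra]. }
    { fold w0. intros w u Hw. apply HDn; lra. }
    { fold w0. intros w u Hw.
      replace (D w mu u) with
        ((D w mu u - (alpha * u + beta * Cconj u)) + (alpha * u + beta * Cconj u))%C by ring.
      eapply Rle_trans; [apply Cmod_triangle |].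
      assert (B1 : Cmod (D w mu u - (alpha * u + beta * Cconj u)) <= eta * Cmod u)
        by (apply HDn; lra).
      assert (B2 : Cmod (alpha * u + beta * Cconj u) <= (Cmod alpha + Cmod beta) * Cmod u).
      { eapply Rle_trans; [apply Cmod_triangle |].
        rewrite !Cmod_mult, Cmod_conj. right. ring. }
      apply Rle_trans with ((Cmod alpha + Cmod beta + eta) * Cmod u); [lra |].
      apply Rmult_le_compat_r; [apply Cmod_ge_0 | unfold k; lra]. }
    { unfold rho. lra. }
    { replace (9 * (Rabs mu * k)) with (9 * k * Rabs mu) by ring. lra. }
    assert (Hconf : Rabs mu * Cmod a ^ 2 < Rabs (Re a)) by (rewrite Hra'; lra).
    assert (HLe : forall u : C, Cmod (L u - u - mu * a * u)
                    <= Rabs mu * (Rabs (Re a) / 2) * Cmod u).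
    { intros u. eapply Rle_trans; [apply HLexp |].
      apply Rmult_le_compat_r; [apply Cmod_ge_0 |].
      replace (9 * (Rabs mu * eta + 18 * (Rabs mu * k) ^ 2))
        with (Rabs mu * (PI * ra / 2 + 9 * (18 * k ^ 2) * Rabs mu))
        by (unfold eta; field).
      apply Rmult_le_compat_l; [exact Hm0 |]. rewrite Hra'. lra. }
    destruct (near_conformal_modulus L a mu Hconf HLe) as [Hcontr Hexp].
    assert (Hsgn : Re a * mu = 2 * PI * (Re alpha * mu)) by (rewrite Ea; ring).
    exists p. split; [split |].
    + split; [| split].
      * split; [exact Hsol |]. split; [| exact Hprot].
        now apply (rotation_periodic j hj).
      * intros Hmu0. exists L. split; [exact HL |]. intros lam Hlam.
        assert (Hne : Re a * mu <> 0).
        { rewrite Hsgn. apply Rmult_integral_contrapositive_currified; [lra |].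
          now apply Rmult_integral_contrapositive_currified. }
        destruct (Rdichotomy _ _ Hne) as [Hneg | Hpos].
        -- apply Rlt_not_eq, (eigenvalue_lt_1 L); auto.
        -- apply Rgt_not_eq, (eigenvalue_gt_1 L); auto.
      * exact Hcenter.
    + intros q ((Hq & _ & Hqrot) & _ & _). apply functional_extensionality. intros t.
      set (z := fun t => (q t - x0 t)%C).
      assert (Eq : q = fun t => (x0 t + z t)%C)
        by (apply functional_extensionality; intros; unfold z; ring).
      assert (Hz : forall t, is_derive_C z t (Y t (z t))).
      { intros u. apply (solution_iff_deviation v g h mu (fun _ => True) z); [| exact I].
        unfold x0 in Eq. rewrite <- Eq. exact Hq. }
      assert (Hzrot : forall t, z (t + T) = (cis T * z t)%C).
      { intros u. unfold z. rewrite Hx0, Hqrot. fold T. ring. }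
      rewrite Eq. unfold p. f_equal.
      apply (rotating_wave_unique T (r / 2) rho (Rabs mu * k) Y); auto.
    + intros Hneg. split; [exact Hcenter |]. exists L. split; [exact HL |].
      intros lam Hlam. apply (eigenvalue_lt_1 L); auto. apply Hcontr.
      rewrite Hsgn.
      assert (0 < 2 * PI * - (Re alpha * mu)) by (apply Rmult_lt_0_compat; lra). lra.
Qed.
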